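(* Let $(N^{2n+1},\varphi,\xi,\eta,g)$ be a Sasakian space form with constant $\varphi$-sectional curvature $c=1$, and let $\gamma:I\to N$ be a non-Legendre Frenet curve of osculating order $r$. Then $\gamma$ is proper-biharmonic if and only if either $\gamma$ is a circle with $\kappa_1=1$, or $\gamma$ is a helix with $\kappa_1^2+\kappa_2^2=1$.
   Context: All manifolds, metrics, connections and maps are smooth. A contact metric manifold $(N^{2n+1},\varphi,\xi,\eta,g)$ consists of a $(1,1)$-tensor field $\varphi$, a vector field $\xi$ (the characteristic vector field), a 1-form $\eta$ and a Riemannian metric $g$ with $\varphi^2=-I+\eta\otimes\xi$, $\eta(\xi)=1$, $g(\varphi X,\varphi Y)=g(X,Y)-\eta(X)\eta(Y)$, $g(X,\varphi Y)=d\eta(X,Y)$, where $d\eta(X,Y)=\frac12(X\eta(Y)-Y\eta(X)-\eta([X,Y]))$. It is Sasakian if $(\nabla_X\varphi)(Y)=g(X,Y)\xi-\eta(Y)X$ for all vector fields $X,Y$, with $\nabla$ the Levi-Civita connection. A Sasakian space form is a Sasakian manifold whose $\varphi$-sectional curvature (the sectional curvature of the planes spanned by $X,\varphi X$, with $X$ a unit vector orthogonal to $\xi$) is a constant $c$. A curve $\gamma:I\to N$ parametrized by arc length is a Frenet curve of osculating order $r$ ($1\le r\le \dim N$) if there are orthonormal vector fields $E_1=\gamma'=T,E_2,\dots,E_r$ along $\gamma$ with $\nabla_TE_1=\kappa_1E_2$, $\nabla_TE_2=-\kappa_1E_1+\kappa_2E_3$, ..., $\nabla_TE_r=-\kappa_{r-1}E_{r-1}$,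 where $\kappa_1,\dots,\kappa_{r-1}$ are positive functions on $I$. A Frenet curve of osculating order 1 is a geodesic; a circle is a Frenet curve of osculating order 2 with $\kappa_1$ constant; a helix is a Frenet curve of osculating order 3 with $\kappa_1,\kappa_2$ constant. The curve $\gamma$ is non-Legendre: $\eta(T)=f$ with $f$ a function along $\gamma$, $f\neq0$. A curve $\gamma$ parametrized by arc length is biharmonic if $\tau_2(\gamma)=\nabla_T^3T-R(T,\nabla_TT)T=0$, where $R(X,Y)=[\nabla_X,\nabla_Y]-\nabla_{[X,Y]}$; it is proper-biharmonic if it is biharmonic and not harmonic (i.e. not a geodesic). *)

(* Defs.v *)
From HB Require Import structures.
From mathcomp Require Import all_boot all_order all_algebra.
From mathcomp Require Import all_classical all_reals all_analysis.
From mathcomp Require Import ring.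

Set Implicit Arguments.
Unset Strict Implicit.
Unset Printing Implicit Defensive.

Import Order.TTheory GRing.Theory Num.Theory.
Import numFieldNormedType.Exports.
Local Open Scope classical_set_scope.
Local Open Scope ring_scope.

Section Smooth.
Context {R : realType}.
Implicit Types V W : normedModType R.

(* Meaningful for open [U] only. In finite dimension the (k+1)-st clause says
   that f is differentiable with a C^k differential. *)
Fixpoint Ck V W (k : nat) (U : set V) (f : V -> W) : Prop :=
  match k with
  | 0%N => forall x, U x -> {for x, continuous f}
  | k'.+1 => (forall x, U x -> differentiable f x) /\
             forall v, Ck k' U ('D_v f)
  end.

Definition smooth_on V W (U : set V) (f : V -> W) : Prop :=
  forall k, Ck k U f.

Lemma near_eq_differentiable V W (f g : V -> W) (x : V) :
  (\near x, f x = g x) -> differentiable f x -> differentiable g x.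
Proof.
move=> fg /diff_locallyP[cdf ef].
have fgx : f x = g x by exact: (nbhs_singleton fg).
have eg : g \o shift x = cst (g x) + 'd f x +o_ 0 id.
  apply/eqaddoP => e e0; move/eqaddoP: ef => /(_ e e0).
  have fg0 : \forall h \near 0, f (h + x) = g (h + x).
    by move: fg; rewrite [X in X -> _](near_shift 0) subr0.
  apply: filterS2 fg0 => h /= fgh.
  by rewrite !fctE /= fgh fgx.
have dg := diff_unique cdf eg.
by apply/diff_locallyP; rewrite dg.
Qed.

Lemma Ck_eq V W k (U : set V) (f g : V -> W) : open U ->
  (forall x, U x -> f x = g x) -> Ck k U f -> Ck k U g.
Proof.
move=> oU; elim: k f g => [|k IHk] f g fg /=.
  move=> cf x Ux; have cfx : f @ x --> f x := cf x Ux.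
  change (g @ x --> g x); rewrite -(fg x Ux).
  apply: cvg_trans cfx; apply: near_eq_cvg.
  by apply: filterS (open_nbhs_nbhs (conj oU Ux)) => y /fg.
move=> [df Df].
have nfg x : U x -> \near x, f x = g x.
  by move=> Ux; apply: filterS (open_nbhs_nbhs (conj oU Ux)) => y /fg.
split=> [x Ux|v]; first exact: near_eq_differentiable (nfg x Ux) (df x Ux).
by apply: IHk (Df v) => x Ux; exact: near_eq_derive (nfg x Ux).
Qed.

Lemma CkW V W k (U : set V) (f : V -> W) : Ck k.+1 U f -> Ck k U f.
Proof.
elim: k f => [|k IHk] f /= [df Df].
  by move=> x /df; exact: differentiable_continuous.
by split => // v; apply: IHk; exact: Df.
Qed.

Lemma smooth_on_cst V W (U : set V) (a : W) : open U ->
  smooth_on U (cst a : V -> W).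
Proof.
move=> oU k; elim: k a => [|k IHk] a; first by move=> x _; exact: cst_continuous.
split=> [x _|v]; first exact: differentiable_cst.
by apply: Ck_eq (IHk 0) => // x _; rewrite derive_cst.
Qed.

Lemma CkD V W k (U : set V) (f g : V -> W) : open U ->
  Ck k U f -> Ck k U g -> Ck k U (f \+ g).
Proof.
move=> oU; elim: k f g => [|k IHk] f g.
  by move=> cf cg x Ux; apply: continuousD; [exact: cf|exact: cg].
move=> [df Df] [dg Dg]; split=> [x Ux|v].
  by apply: differentiableD; [exact: df|exact: dg].
apply: Ck_eq (IHk _ _ (Df v) (Dg v)) => // x Ux.
by rewrite deriveD//; apply: diff_derivable; [exact: df|exact: dg].
Qed.

Lemma CkM V k (U : set V) (f g : V -> R) : open U ->
  Ck k U f -> Ck k U g -> Ck k U (f \* g).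
Proof.
move=> oU; elim: k f g => [|k IHk] f g.
  by move=> cf cg x Ux; apply: continuousM; [exact: cf|exact: cg].
move=> Cf Cg; have [df Df] := Cf; have [dg Dg] := Cg; split=> [x Ux|v].
  by apply: differentiableM; [exact: df|exact: dg].
apply: Ck_eq (CkD oU (IHk _ _ (CkW Cf) (Dg v)) (IHk _ _ (CkW Cg) (Df v))) => //.
move=> x Ux; rewrite deriveM//; apply: diff_derivable; [exact: df|exact: dg].
Qed.

End Smooth.

(* [cto] and [cfrom] are total functions, only relevant on [cdom] and [ccod]. *)
Record chart (R : realType) (d : nat) (M : topologicalType) := Chart {
  cdom : set M;
  ccod : set 'rV[R]_d;
  cto : M -> 'rV[R]_d;
  cfrom : 'rV[R]_d -> M;
  cdom_open : open cdom;
  ccod_open : open ccod;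
  cto_cod : forall p, cdom p -> ccod (cto p);
  cfrom_dom : forall x, ccod x -> cdom (cfrom x);
  ctoK : forall p, cdom p -> cfrom (cto p) = p;
  cfromK : forall x, ccod x -> cto (cfrom x) = x;
  cto_continuous : forall p, cdom p -> {for p, continuous cto};
  cfrom_continuous : forall x, ccod x -> {for x, continuous cfrom} }.

Record manifold (R : realType) (d : nat) := Manifold {
  mspace :> topologicalType;
  mhausdorff : hausdorff_space mspace;
  msecond_countable : @second_countable mspace;
  atlas : set (chart R d mspace);
  atlas_cover : forall p, exists2 c, atlas c & cdom c p;
  atlas_compatible : forall c c', atlas c -> atlas c' ->
    smooth_on (ccod c `&` cfrom c @^-1` cdom c') (cto c' \o cfrom c) }.

Section SmoothFunctions.
Context {R : realType} {d : nat}.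
Variable M : manifold R d.

Definition smooth_fun (f : M -> R) : Prop :=
  forall c, atlas c -> smooth_on (ccod c) (f \o cfrom c).

Definition smooth_pred : {pred M -> R} := fun f => `[< smooth_fun f >].

Record cinf := Cinf { cfun :> M -> R; cfunP : cfun \in smooth_pred }.
HB.instance Definition _ := [isSub for cfun].
HB.instance Definition _ := [Choice of cinf by <:].

Lemma smooth_cst (a : R) : smooth_fun (cst a).
Proof. by move=> c _; apply: smooth_on_cst; exact: ccod_open. Qed.

Lemma smoothD (f g : M -> R) :
  smooth_fun f -> smooth_fun g -> smooth_fun (f \+ g).
Proof.
move=> sf sg c ac k.
by apply: CkD; [exact: ccod_open|exact: sf|exact: sg].
Qed.

Lemma smoothM (f g : M -> R) :
  smooth_fun f -> smooth_fun g -> smooth_fun (f \* g).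
Proof.
move=> sf sg c ac k.
by apply: CkM; [exact: ccod_open|exact: sf|exact: sg].
Qed.

Lemma smoothN (f : M -> R) : smooth_fun f -> smooth_fun (\- f).
Proof.
move=> sf; have -> : (\- f) = cst (-1) \* f.
  by apply/funext => p /=; rewrite mulN1r.
by apply: smoothM => //; exact: smooth_cst.
Qed.

Lemma smooth_subring_closed : subring_closed smooth_pred.
Proof.
split=> [|f g /asboolP sf /asboolP sg|f g /asboolP sf /asboolP sg]; apply/asboolP.
- exact: smooth_cst.
- by apply: smoothD => //; exact: smoothN.
- exact: smoothM.
Qed.
HB.instance Definition _ :=
  GRing.isSubringClosed.Build _ smooth_pred smooth_subring_closed.

Lemma smooth_scaler_closed : GRing.scaler_closed smooth_pred.
Proof.
move=> a f /asboolP sf; apply/asboolP.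
by have := smoothM (smooth_cst a) sf.
Qed.
HB.instance Definition _ :=
  GRing.isScaleClosed.Build _ _ smooth_pred smooth_scaler_closed.

HB.instance Definition _ := 
  GRing.SubChoice_isSubComPzRing.Build _ _ cinf (subringClosedP _).
HB.instance Definition _ := [SubZmodule_isSubLmodule of cinf by <:].

Lemma cinf_smooth (f : cinf) : smooth_fun f.
Proof. exact/asboolP/cfunP. Qed.

Definition to_cinf (f : M -> R) (sf : smooth_fun f) : cinf :=
  Cinf (introT (asboolP _) sf).

End SmoothFunctions.

Section TangentSpace.
Context {R : realType} {d : nat}.
Variables (M : manifold R d) (p : M).

Definition derivation_at (v : cinf M -> R) : Prop :=
  (forall (a : R) (f h : cinf M), v (a *: f + h) = a * v f + v h) /\
  (forall f h : cinf M, v (f * h) = f p * v h + h p * v f).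

Definition derivation_pred : {pred cinf M -> R} :=
  fun v => `[< derivation_at v >].

Record tangent :=
  Tangent { tfun :> cinf M -> R; tfunP : tfun \in derivation_pred }.
HB.instance Definition _ := [isSub for tfun].
HB.instance Definition _ := [Choice of tangent by <:].

Lemma derivation_submod_closed : GRing.submod_closed derivation_pred.
Proof.
split=> [|a u v /asboolP[ul uL] /asboolP[vl vL]]; apply/asboolP.
  have E w : (0 : cinf M -> R) w = 0 by [].
  by split=> [b f h|f h]; rewrite !E; ring.
have E w : (a *: u + v) w = a * u w + v w by [].
by split=> [b f h|f h]; rewrite !E ?ul ?vl ?uL ?vL; ring.
Qed.
HB.instance Definition _ :=
  GRing.isSubmodClosed.Build _ _ derivation_pred derivation_submod_closed.
HB.instance Definition _ := [SubChoice_isSubLmodule of tangent by <:].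

Definition to_tangent (v : cinf M -> R) (dv : derivation_at v) : tangent :=
  Tangent (introT (asboolP _) dv).

Lemma tangent_lin (v : tangent) (a : R) (f h : cinf M) :
  v (a *: f + h) = a * v f + v h.
Proof. by have /asboolP[] := tfunP v. Qed.

Lemma tangent_leibniz (v : tangent) (f h : cinf M) :
  v (f * h) = f p * v h + h p * v f.
Proof. by have /asboolP[] := tfunP v. Qed.

End TangentSpace.

Section VectorFields.
Context {R : realType} {d : nat}.
Variable M : manifold R d.

Record vfield := VField {
  vf :> forall p : M, tangent p;
  vf_smooth : forall f : cinf M, smooth_fun (fun p => vf p f) }.

HB.instance Definition _ := gen_eqMixin vfield.
HB.instance Definition _ := gen_choiceMixin vfield.

Definition vf_app (X : vfield) (f : cinf M) : cinf M :=
  to_cinf (vf_smooth X f).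

Lemma vf0_smooth (f : cinf M) : smooth_fun (fun p => (0 : tangent p) f).
Proof. exact: (smooth_cst (0 : R)). Qed.
Definition vf0 : vfield := VField vf0_smooth.

Lemma vf_add_smooth (X Y : vfield) (f : cinf M) :
  smooth_fun (fun p => (X p + Y p) f).
Proof. exact: smoothD (vf_smooth X f) (vf_smooth Y f). Qed.
Definition vf_add (X Y : vfield) : vfield := VField (vf_add_smooth X Y).

Lemma vf_scale_smooth (h : cinf M) (X : vfield) (f : cinf M) :
  smooth_fun (fun p => (h p *: X p) f).
Proof. exact: smoothM (cinf_smooth h) (vf_smooth X f). Qed.
Definition vf_scale (h : cinf M) (X : vfield) : vfield :=
  VField (vf_scale_smooth h X).

Lemma bracket_derivation (X Y : vfield) (p : M) :
  derivation_at p (fun f => X p (vf_app Y f) - Y p (vf_app X f)).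
Proof.
have lin (Z : vfield) a f h :
    vf_app Z (a *: f + h) = a *: vf_app Z f + vf_app Z h.
  by apply/val_inj/funext => q; exact: tangent_lin.
have leib (Z : vfield) f h :
    vf_app Z (f * h) = f * vf_app Z h + h * vf_app Z f.
  by apply/val_inj/funext => q; exact: tangent_leibniz.
have add (Z : vfield) f h : Z p (f + h) = Z p f + Z p h.
  by rewrite -[f]scale1r tangent_lin mul1r scale1r.
split=> [a f h|f h].
  by rewrite !lin !tangent_lin; ring.
rewrite !leib !add !tangent_leibniz /=; ring.
Qed.

Definition bracket_at (X Y : vfield) (p : M) : tangent p :=
  to_tangent (bracket_derivation X Y p).

Lemma bracket_smooth (X Y : vfield) (f : cinf M) :
  smooth_fun (fun p => bracket_at X Y p f).
Proof.
exact: smoothD (vf_smooth X (vf_app Y f))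
               (smoothN (vf_smooth Y (vf_app X f))).
Qed.
Definition bracket (X Y : vfield) : vfield := VField (bracket_smooth X Y).

End VectorFields.

Section Tensors.
Context {R : realType} {d : nat}.
Variable M : manifold R d.

(* A tensor field is a family of (multi)linear maps on the tangent spaces that
   sends smooth vector fields to a smooth function or vector field. *)
Record oneform := OneForm {
  of_fun :> forall p : M, tangent p -> R;
  of_lin : forall p (a : R) (u v : tangent p),
    of_fun (a *: u + v) = a * of_fun u + of_fun v;
  of_smooth : forall X : vfield M, smooth_fun (fun p => of_fun (X p)) }.

Record endofield := EndoField {
  ef_fun :> forall p : M, tangent p -> tangent p;
  ef_lin : forall p (a : R) (u v : tangent p),
    ef_fun (a *: u + v) = a *: ef_fun u + ef_fun v;
  ef_smooth : forall (X : vfield M) (f : cinf M),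
    smooth_fun (fun p => ef_fun (X p) f) }.

Record metric := Metric {
  gm :> forall p : M, tangent p -> tangent p -> R;
  gm_lin : forall p (a : R) (u v w : tangent p),
    gm (a *: u + v) w = a * gm u w + gm v w;
  gm_sym : forall p (u v : tangent p), gm u v = gm v u;
  gm_pos : forall p (u : tangent p), u != 0 -> 0 < gm u u;
  gm_smooth : forall X Y : vfield M, smooth_fun (fun p => gm (X p) (Y p)) }.

Definition of_app (eta : oneform) (X : vfield M) : cinf M :=
  to_cinf (of_smooth eta X).
Definition ef_app (phi : endofield) (X : vfield M) : vfield M :=
  VField (ef_smooth phi X).
Definition gm_app (g : metric) (X Y : vfield M) : cinf M :=
  to_cinf (gm_smooth g X Y).

(* The convention for d eta with the factor 1/2. *)
Definition dform (eta : oneform) (X Y : vfield M) (p : M) : R :=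
  2^-1 * (X p (of_app eta Y) - Y p (of_app eta X) - eta p (bracket X Y p)).

(* [cn v Y] is the covariant derivative of Y in the direction of v. *)
Record connection := Connection {
  cn :> forall p : M, tangent p -> vfield M -> tangent p;
  cn_lin : forall p (a : R) (u v : tangent p) (Y : vfield M),
    cn (a *: u + v) Y = a *: cn u Y + cn v Y;
  cn_add : forall p (v : tangent p) (Y Z : vfield M),
    cn v (vf_add Y Z) = cn v Y + cn v Z;
  cn_leibniz : forall p (v : tangent p) (f : cinf M) (Y : vfield M),
    cn v (vf_scale f Y) = v f *: Y p + f p *: cn v Y;
  cn_smooth : forall (X Y : vfield M) (f : cinf M),
    smooth_fun (fun p => cn (X p) Y f) }.

Definition cn_app (nabla : connection) (X Y : vfield M) : vfield M :=
  VField (cn_smooth nabla X Y).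

Definition levi_civita (g : metric) (nabla : connection) : Prop :=
  (forall (X Y : vfield M) (p : M),
     nabla p (X p) Y - nabla p (Y p) X = bracket X Y p) /\
  (forall (p : M) (v : tangent p) (Y Z : vfield M),
     v (gm_app g Y Z) = g p (nabla p v Y) (Z p) + g p (Y p) (nabla p v Z)).

Definition curv (nabla : connection) (X Y Z : vfield M) (p : M) : tangent p :=
  cn_app nabla X (cn_app nabla Y Z) p - cn_app nabla Y (cn_app nabla X Z) p
  - cn_app nabla (bracket X Y) Z p.

(* A vector field with the value v at p.  [curv] being tensorial, the choice
   does not affect the value of [Riem] below. *)
Definition extend (p : M) (v : tangent p) : vfield M :=
  xget (vf0 M) [set X : vfield M | X p = v].

Definition Riem (nabla : connection) (p : M) (u v w : tangent p) : tangent p :=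
  curv nabla (extend u) (extend v) (extend w) p.

Definition sectional (g : metric) (nabla : connection) (p : M)
    (u v : tangent p) : R :=
  g p (Riem nabla u v v) u / (g p u u * g p v v - g p u v ^+ 2).

Definition contact_metric (phi : endofield) (xi : vfield M) (eta : oneform)
    (g : metric) : Prop :=
  [/\ forall (p : M) (u : tangent p),
        phi p (phi p u) = - u + eta p u *: xi p,
      forall p : M, eta p (xi p) = 1,
      forall (p : M) (u v : tangent p),
        g p (phi p u) (phi p v) = g p u v - eta p u * eta p v &
      forall (X Y : vfield M) (p : M),
        g p (X p) (phi p (Y p)) = dform eta X Y p].

Definition sasakian (phi : endofield) (xi : vfield M) (eta : oneform)
    (g : metric) (nabla : connection) : Prop :=
  contact_metric phi xi eta g /\
  forall (X Y : vfield M) (p : M),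
    nabla p (X p) (ef_app phi Y) - phi p (nabla p (X p) Y) =
    g p (X p) (Y p) *: xi p - eta p (Y p) *: X p.

Definition sasakian_space_form (phi : endofield) (xi : vfield M)
    (eta : oneform) (g : metric) (nabla : connection) (c : R) : Prop :=
  sasakian phi xi eta g nabla /\
  forall (p : M) (u : tangent p), g p u u = 1 -> g p u (xi p) = 0 ->
    sectional g nabla u (phi p u) = c.

End Tensors.

Section Curves.
Context {R : realType} {d : nat}.
Variable M : manifold R d.

Definition open_interval (I : set R) : Prop :=
  [/\ open I, is_interval I & I !=set0].

(* Curves are total functions, only relevant on the open interval [I]. *)
Definition smooth_curve (I : set R) (gamma : R -> M) : Prop :=
  (forall t, I t -> {for t, continuous gamma}) /\
  forall c, atlas c ->
    smooth_on (I `&` gamma @^-1` cdom c) (cto c \o gamma).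

Variables (I : set R) (gamma : R -> M).

Definition along := forall t : R, tangent (gamma t).

(* The velocity at t is the derivation f |-> (f \o gamma)'(t); by the chain
   rule the default value 0 is not used where gamma is smooth. *)
Definition velocity : along :=
  fun t => insubd (0 : tangent (gamma t))
    (fun f : cinf M => (f \o gamma)^`()%classic t).

Definition smooth_along (V : along) : Prop :=
  forall f : cinf M, smooth_on I (fun t => V t f).

(* The characteristic properties of the covariant derivative of vector fields
   along gamma induced by nabla; they determine D V on I for smooth V. *)
Record covariant_derivative_along (nabla : connection M) (D : along -> along)
    : Prop := CovariantDerivativeAlong {
  cda_smooth : forall V, smooth_along V -> smooth_along (D V);
  cda_add : forall V W, smooth_along V -> smooth_along W ->
    forall t, I t -> D (fun s => V s + W s) t = D V t + D W t;
  cda_leibniz : forall (h : R -> R) V, smooth_on I h -> smooth_along V ->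
    forall t, I t ->
      D (fun s => h s *: V s) t = h^`()%classic t *: V t + h t *: D V t;
  cda_nabla : forall X : vfield M, forall t, I t ->
    D (fun s => X (gamma s)) t = nabla (gamma t) (velocity t) X }.

Variables (g : metric M) (nabla : connection M) (D : along -> along).

(* Frame and curvatures are indexed from 1. *)
Record frenet_frame (r : nat) (E : nat -> along) (kappa : nat -> R -> R)
    : Prop := FrenetFrame {
  ff_order : (1 <= r <= d)%N;
  ff_smooth : forall i, (1 <= i <= r)%N -> smooth_along (E i);
  ff_orthonormal : forall i j, (1 <= i <= r)%N -> (1 <= j <= r)%N ->
    forall t, I t -> g (gamma t) (E i t) (E j t) = (i == j)%:R;
  ff_tangent : forall t, I t -> E 1%N t = velocity t;
  ff_kappa_smooth : forall i, (1 <= i < r)%N -> smooth_on I (kappa i);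
  ff_kappa_pos : forall i, (1 <= i < r)%N -> forall t, I t -> 0 < kappa i t;
  ff_frenet : forall i, (1 <= i <= r)%N -> forall t, I t ->
    D (E i) t =
      (if (1 < i)%N then - kappa i.-1 t *: E i.-1 t else 0) +
      (if (i < r)%N then kappa i t *: E i.+1 t else 0) }.

Definition frenet_curve (r : nat) : Prop :=
  exists E kappa, frenet_frame r E kappa.

Definition circle (k1 : R) : Prop :=
  exists E kappa, frenet_frame 2 E kappa /\ forall t, I t -> kappa 1%N t = k1.

Definition helix (k1 k2 : R) : Prop :=
  exists E kappa, frenet_frame 3 E kappa /\
    forall t, I t -> kappa 1%N t = k1 /\ kappa 2%N t = k2.

Definition non_legendre (eta : oneform M) : Prop :=
  exists2 t, I t & eta (gamma t) (velocity t) != 0.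

Definition geodesic : Prop := forall t, I t -> D velocity t = 0.

Definition bitension : along := fun t =>
  D (D (D velocity)) t - Riem nabla (velocity t) (D velocity t) (velocity t).

Definition biharmonic : Prop := forall t, I t -> bitension t = 0.

Definition proper_biharmonic : Prop := biharmonic /\ ~ geodesic.

End Curves.

(* Main.v *)
Require Import Defs.
From HB Require Import structures.
From mathcomp Require Import all_boot all_order all_algebra.
From mathcomp Require Import all_classical all_reals all_analysis.
From mathcomp Require Import ring lra.

Set Implicit Arguments.
Unset Strict Implicit.
Unset Printing Implicit Defensive.

Import Order.TTheory GRing.Theory Num.Theory.
Import numFieldNormedType.Exports.
Local Open Scope classical_set_scope.
Local Open Scope ring_scope.

(** The Sasakian space form of [phi]-sectional curvature 1 has constant sectional
    curvature 1, so along a unit speed curve with unit tangent T the biharmonic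
    equation is D^3 T + D T = 0. In a Frenet frame E_1, E_2, ... with curvatures
    k_1, k_2, ... (0 beyond the osculating order) its left side is
    - 3 k_1 k_1' E_1 + (k_1'' - k_1 (k_1^2 + k_2^2 - 1)) E_2
    + (2 k_1' k_2 + k_1 k_2') E_3 + k_1 k_2 k_3 E_4 ([bitensionE]). If this
    vanishes and k_1 > 0, then k_1 is constant, k_1^2 + k_2^2 = 1 and the order is
    2 or 3 ([biharmonic_curvatures]): a circle with k_1 = 1 or a helix. Conversely
    all components vanish in these two cases, and k_1 <> 0 excludes geodesics.

    The substance is the statement about the curvature, [Riem_space_form]. The
    Sasakian condition implies that the derivative of xi along v is - phi v, that
    R(X, Y) xi = eta(Y) X - eta(X) Y, and that R minus the curvature tensor of the
    unit sphere commutes with [phi] ([cn_xi], [curv_xi], [curv_phi]). This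
    difference is thus a tensor of Kaehler type on the complement of xi whose
    holomorphic sectional curvature vanishes, and polarization with the Bianchi
    identity shows that it is 0 ([holsec_zero]).

    Tangent vectors are derivations of the algebra of smooth functions, and the
    curvature of three tangent vectors is computed on arbitrary extensions to
    vector fields. Hence one also needs that extensions exist ([extendE]) and that
    the curvature does not depend on them ([tensorial], [curv_pointwise]). Both
    follow from [frame_expansion]: up to the cube of a bump function b, every
    tangent vector, and every vector field, is a combination of the fields
    b d/dx_i, with explicit coefficients. This rests on the existence of smooth
    bump functions and on Hadamard's lemma, that a smooth f near q is
    f(q) + sum_i (x_i - q_i) g_i with smooth g_i; there g_i is the integral over t
    in [0, 1] of the i-th partial derivative of f at q + t (x - q). *)

(** * Smooth functions on normed spaces *)

Section CkCalculus.
Context {R : realType}.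
Implicit Types V W : normedModType R.

(** Each clause of [Ck] tests [f] at the points of [U] only, through germs, so
    [U] may be cut down to singletons; hence smoothness is a local property. *)
Lemma Ck_pointwise V W k (U : set V) (f : V -> W) :
  Ck k U f <-> forall x, U x -> Ck k [set x] f.
Proof.
elim: k f => [|k IHk] f /=; first by split=> [cf x /cf fx _ ->|cf x /cf]; last exact.
split=> [[df Df] x Ux|cf].
  by split=> [_ ->|v]; [exact: df|have /IHk := Df v; exact].
split=> [x /cf[+ _]|v]; first exact.
by apply/IHk => x /cf[_]; exact.
Qed.

Lemma Ck_sub V W k (U U' : set V) (f : V -> W) :
  U `<=` U' -> Ck k U' f -> Ck k U f.
Proof. by move=> UU' /Ck_pointwise cf; apply/Ck_pointwise => x /UU'/cf. Qed.

Lemma Ck_local V W k (U : set V) (f : V -> W) :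
  (forall x, U x -> exists2 U', U' x & Ck k U' f) -> Ck k U f.
Proof.
by move=> cf; apply/Ck_pointwise => x /cf[U' U'x]; apply: Ck_sub => _ ->.
Qed.

Lemma Ck_le V W k l (U : set V) (f : V -> W) : (k <= l)%N -> Ck l U f -> Ck k U f.
Proof.
move=> /subnK <-; elim: (l - k)%N => // m IHm Cf.
by apply: IHm; exact: CkW.
Qed.

Lemma Ck_sum V W k (U : set V) m (f : 'I_m -> V -> W) : open U ->
  (forall i, Ck k U (f i)) -> Ck k U (\sum_i f i).
Proof.
move=> oU; elim: m f => [|m IHm] f cf.
  by rewrite big_ord0; exact: (@smooth_on_cst _ _ _ _ 0).
by rewrite big_ord_recl; apply: CkD => //; exact: IHm.
Qed.

Lemma Ck_prod V k (U : set V) m (f : 'I_m -> V -> R) : open U ->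
  (forall i, Ck k U (f i)) -> Ck k U (fun x => \prod_i f i x).
Proof.
move=> oU; elim: m f => [|m IHm] f cf.
  rewrite (_ : (fun _ => _) = cst 1); first exact: smooth_on_cst.
  by apply/funext => x; rewrite big_ord0.
rewrite (_ : (fun _ => _) = f ord0 \* (fun x => \prod_i f (lift ord0 i) x)).
  by apply: CkM => //; exact: IHm.
by apply/funext => x; rewrite big_ord_recl.
Qed.

Lemma smooth_derive V W (U : set V) (f : V -> W) v :
  smooth_on U f -> smooth_on U ('D_v f).
Proof. by move=> sf k; have [_] := sf k.+1; exact. Qed.

Lemma smooth_diff V W (U : set V) (f : V -> W) x :
  smooth_on U f -> U x -> differentiable f x.
Proof. by move=> sf; have [df _] := sf 1%N; exact: df. Qed.

(** A continuous linear map has constant directional derivatives. *)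
Lemma Ck_linear V W k (U : set V) (L : {linear V -> W}) : continuous L ->
  open U -> Ck k U L.
Proof.
move=> cL oU; case: k => [|k]; first by move=> x _; exact: cL.
split=> [x _|v]; first exact: linear_differentiable.
rewrite (_ : 'D_v _ = cst (L v)); first exact: smooth_on_cst.
apply/funext => x; rewrite deriveE; last exact: linear_differentiable.
by rewrite diff_lin.
Qed.

Definition coord_form m (i : 'I_m) (x : 'rV[R]_m) : R := x 0 i.
Fact coord_form_linear m (i : 'I_m) : linear (@coord_form m i).
Proof. by move=> a x y; rewrite /coord_form !mxE. Qed.
HB.instance Definition _ m (i : 'I_m) :=
  GRing.isLinear.Build R 'rV[R]_m R _ (@coord_form m i) (@coord_form_linear m i).

Lemma Ck_coord m k (U : set 'rV[R]_m) (i : 'I_m) : open U ->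
  Ck k U (fun x : 'rV[R]_m => x 0 i).
Proof. by apply: (@Ck_linear _ _ _ _ (@coord_form m i)); exact: coord_continuous. Qed.

Lemma deriveE_coord m (f : 'rV[R]_m -> R) (x v : 'rV[R]_m) :
  differentiable f x ->
  'D_v f x = \sum_i v 0 i * 'D_(delta_mx 0 i) f x.
Proof.
move=> df; rewrite deriveE// {1}(row_sum_delta v) linear_sum.
by apply: eq_bigr => i _; rewrite linearZ deriveE.
Qed.

Lemma derive_row_coord V m (h : V -> 'rV[R]_m) (i : 'I_m) (x v : V) :
  differentiable h x -> 'D_v (fun y => h y 0 i) x = ('D_v h x) 0 i.
Proof.
by move=> dh; rewrite derive_mx ?mxE//; exact: diff_derivable.
Qed.

Lemma derive_comp_coord V m (h : V -> 'rV[R]_m) (f : 'rV[R]_m -> R) (x v : V) :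
  differentiable h x -> differentiable f (h x) ->
  'D_v (f \o h) x = \sum_i 'D_v (fun y => h y 0 i) x * 'D_(delta_mx 0 i) f (h x).
Proof.
move=> dh df.
rewrite [LHS]deriveE; last exact: differentiable_comp.
rewrite diff_comp//= -(deriveE v dh) -(deriveE _ df) (deriveE_coord _ df).
by apply: eq_bigr => i _; rewrite derive_row_coord.
Qed.

Lemma Ck_row_coord V m k (U : set V) (h : V -> 'rV[R]_m) (i : 'I_m) : open U ->
  Ck k U h -> Ck k U (fun x => h x 0 i).
Proof.
move=> oU; elim: k h => [|k IHk] h.
  move=> ch x Ux.
  apply: (@continuous_comp _ _ _ h (@coord_form m i)); first exact: ch.
  exact: coord_continuous.
move=> [dh Dh]; split=> [x Ux|v].
  apply: (@differentiable_comp _ _ _ _ h (@coord_form m i)); first exact: dh.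
  by apply: linear_differentiable; exact: coord_continuous.
apply: Ck_eq (IHk _ (Dh v)) => // x Ux.
by rewrite derive_row_coord//; exact: dh.
Qed.

(** By the chain rule in coordinates each directional derivative of [f \o h]
    is a sum of products of derivatives of [h] with compositions of partial
    derivatives of [f] with [h], to which the induction hypothesis applies. *)
Lemma Ck_comp V m k (U : set V) (U' : set 'rV[R]_m) (h : V -> 'rV[R]_m)
    (f : 'rV[R]_m -> R) : open U -> (forall x, U x -> U' (h x)) ->
  Ck k U h -> Ck k U' f -> Ck k U (f \o h).
Proof.
move=> oU hU; elim: k f => [|k IHk] f.
  move=> ch cf x Ux; apply: (@continuous_comp _ _ _ h f); [exact: ch|exact: (cf _ (hU _ Ux))].
move=> Ch [df Df]; have [dh Dh] := Ch; split=> [x Ux|v].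
  by apply: (@differentiable_comp _ _ _ _ h f); [exact: dh|exact/df/hU].
apply: (@Ck_eq _ _ _ _ _ (\sum_i ((fun x => 'D_v (fun y => h y 0 i) x) \*
          ('D_(delta_mx 0 i) f \o h)))) => //.
  move=> x Ux; rewrite derive_comp_coord; [|exact: dh|exact/df/hU].
  by rewrite fct_sumE.
apply: Ck_sum => // i; apply: CkM => //; last first.
  by apply: IHk; [exact: CkW Ch|exact: Df].
by have [_ Dhi] := Ck_row_coord (k := k.+1) i oU Ch; exact: Dhi.
Qed.

Lemma derive_comp1 V (u : V -> R) (h : R -> R) (x v : V) :
  differentiable u x -> differentiable h (u x) ->
  'D_v (h \o u) x = 'D_v u x * 'D_1 h (u x).
Proof.
move=> du dh; rewrite !deriveE//; last exact: differentiable_comp.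
by rewrite diff_comp//= -[X in 'd h _ X]mulr1 linearZ.
Qed.

Lemma Ck_comp1 V k (U : set V) (U' : set R) (u : V -> R) (h : R -> R) : open U ->
  (forall x, U x -> U' (u x)) -> Ck k U u -> Ck k U' h -> Ck k U (h \o u).
Proof.
move=> oU uU; elim: k h => [|k IHk] h.
  move=> cu ch x Ux; apply: (@continuous_comp _ _ _ u h); [exact: cu|exact: (ch _ (uU _ Ux))].
move=> Cu [dh Dh]; have [du Du] := Cu; split=> [x Ux|v].
  by apply: (@differentiable_comp _ _ _ _ u h); [exact: du|exact/dh/uU].
apply: (@Ck_eq _ _ _ _ _ ('D_v u \* ('D_1 h \o u))) => //.
  by move=> x Ux; rewrite derive_comp1//; [exact: du|exact/dh/uU].
apply: CkM; [exact: oU|exact: Du|].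
by apply: IHk; [exact: CkW Cu|exact: Dh].
Qed.

End CkCalculus.

(** * Bump functions *)

Section Bump.
Context {R : realType}.

(** The powers of [x^-1] are there because their span is closed under
    derivation, whereas exp(-1/x) alone is not. *)
Definition flat (n : nat) (x : R) : R :=
  if 0 < x then x^-1 ^+ n * expR (- x^-1) else 0.

Lemma flat_ge0 n x : 0 <= flat n x.
Proof.
rewrite /flat; case: ifPn => // x0.
by rewrite mulr_ge0 ?expR_ge0// exprn_ge0// invr_ge0 ltW.
Qed.

(** With y = 1/x this says that exp y dominates y^(n+1) / (n+1)!. *)
Lemma flat_le n x : flat n x <= n.+1`!%:R * `|x|.
Proof.
rewrite /flat; case: ifPn => x0; last by rewrite mulr_ge0.
have y0 : 0 <= x^-1 by rewrite invr_ge0 ltW.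
have fac0 : 0 < n.+1`!%:R :> R by rewrite ltr0n fact_gt0.
have le : x^-1 ^+ n.+1 <= n.+1`!%:R * expR x^-1.
  rewrite -ler_pdivrMl// mulrC; apply: le_trans (expR_ge1Dxn n y0).
  by rewrite lerDr.
rewrite gtr0_norm// expRN ler_pdivrMr ?expR_gt0//.
rewrite -(ler_pM2l (x := x^-1)) ?invr_gt0// -exprS; apply: le_trans le _.
by rewrite [leRHS]mulrA mulrCA (mulVf (lt0r_neq0 x0)) mulr1.
Qed.

Lemma flat_cvg0 n : flat n h @[h --> (0:R)^'] --> (0:R).
Proof.
apply/cvgrPdist_le => e e0.
have fac0 : 0 < n.+1`!%:R :> R by rewrite ltr0n fact_gt0.
near=> h; rewrite sub0r normrN ger0_norm ?flat_ge0//.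
apply: le_trans (flat_le n h) _; rewrite -ler_pdivlMl//.
by near: h; apply: dnbhs0_le; rewrite mulr_gt0// invr_gt0.
Unshelve. all: by end_near. Qed.

(** The only delicate point is 0, where the difference quotient of [flat n] is
    [flat n.+1], which tends to 0. *)
Lemma is_derive_flat n (x : R) :
  is_derive x (1 : R) (flat n) (flat n.+2 x - n%:R * flat n.+1 x).
Proof.
have [x0|x0|->] := ltgtP x 0.
- have e : {near x, cst 0 =1 flat n}.
    near=> y; rewrite /= /flat ifF//; apply/negbTE; rewrite -leNgt ltW//.
    by near: y; exact: lt_nbhsl.
  apply: (near_eq_is_derive e).
  by apply: is_derive_eq; rewrite /flat ltNge ltW//= mulr0 subr0.
- have e : {near x, (fun y => y^-1 ^+ n * expR (- y^-1)) =1 flat n}.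
    near=> y; rewrite /= /flat ifT//.
    by near: y; exact: lt_nbhsr.
  apply: (near_eq_is_derive e).
  have xN0 : x != 0 by rewrite gt_eqF.
  have dV : is_derive x 1 (fun y : R => y^-1) (- x ^- 2).
    apply: DeriveDef; first exact: derivableV.
    by rewrite deriveV// derive_id [LHS]mulr1.
  have dE : is_derive x 1 (expR \o (fun y : R => - y^-1)) (x ^- 2 * expR (- x^-1)).
    by apply: is_derive_eq; rewrite mulrC opprK.
  rewrite (_ : (fun _ => _) =
    (fun y : R => y^-1) ^+ n * (expR \o (fun y : R => - y^-1))); last first.
    by apply/funext => y /=; rewrite exprfctE.
  apply: is_derive_eq; rewrite /flat x0 exprfctE /= !exprS -!scalerA.
  case: n {e} => [|n] /=.
    by rewrite !mul0r scale0r scaler0 addr0 subr0 expr0 invfM /GRing.scale /= !mulr1 mul1r.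
  by rewrite !exprS expr0 invfM /GRing.scale /= !mulr1; ring.
- have eq : (fun h => h^-1 *: (flat n (h *: 1 + 0) - flat n 0)) @ (0:R)^' --> (0 : R).
    apply: cvg_trans (flat_cvg0 n.+1); apply: near_eq_cvg.
    near=> h; rewrite /flat ltxx subr0 addr0 [h *: 1]mulr1.
    case: ifPn => _; last by rewrite scaler0.
    by rewrite exprS -mulrA.
  apply: DeriveDef; first by apply/cvg_ex; exists 0.
  by rewrite /flat ltxx mulr0 subr0; apply/cvg_lim.
Unshelve. all: by end_near. Qed.

Lemma smooth_flat n : smooth_on setT (flat n).
Proof.
move=> k; elim: k n => [|k IHk] n.
  move=> x _; apply: differentiable_continuous; apply/derivable1_diffP.
  exact: (@ex_derive _ _ _ _ _ _ _ (is_derive_flat n x)).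
have df x : differentiable (flat n) x.
  apply/derivable1_diffP.
  exact: (@ex_derive _ _ _ _ _ _ _ (is_derive_flat n x)).
split=> // v.
apply: (@Ck_eq _ _ _ _ _ (cst v \* (flat n.+2 \+ (cst (- n%:R) \* flat n.+1)))).
- exact: openT.
- move=> x _; rewrite [RHS]deriveE//= -[X in 'd _ _ X]mulr1 linearZ -deriveE//.
  rewrite (@derive_val _ _ _ _ _ _ _ (is_derive_flat n x)).
  by rewrite /= mulNr.
- apply: CkM; [exact: openT|exact: smooth_on_cst openT _|].
  apply: CkD; [exact: openT|exact: IHk|].
  by apply: CkM; [exact: openT|exact: smooth_on_cst openT _|exact: IHk].
Qed.

(** A product of one-variable bumps is supported in an open cube, that is, in a
    ball of the norm that row vectors carry. *)
Definition bump m (a : 'rV[R]_m) (r : R) (x : 'rV[R]_m) : R :=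
  \prod_(i < m) (flat 0 (r - (x 0 i - a 0 i)) * flat 0 (r + (x 0 i - a 0 i))).

Lemma smooth_bump m (a : 'rV[R]_m) r : smooth_on setT (bump a r).
Proof.
move=> k; apply: Ck_prod; first exact: openT.
have oT : open [set: 'rV[R]_m] by exact: openT.
move=> i; apply: (@CkM _ _ _ _ (fun x : 'rV[R]_m => flat 0 (r - (x 0 i - a 0 i)))
  (fun x : 'rV[R]_m => flat 0 (r + (x 0 i - a 0 i)))) => //.
- apply: (@Ck_comp1 _ _ _ _ setT (fun x : 'rV[R]_m => r - (x 0 i - a 0 i)) (flat 0)) => //.
  rewrite (_ : (fun _ => _) = cst (r + a 0 i) \+ (cst (-1) \* (fun x : 'rV[R]_m => x 0 i))).
    apply: CkD => //; first exact: smooth_on_cst.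
    by apply: CkM => //; [exact: smooth_on_cst|exact: Ck_coord].
  by apply/funext => x /=; ring.
  exact: smooth_flat.
- apply: (@Ck_comp1 _ _ _ _ setT (fun x : 'rV[R]_m => r + (x 0 i - a 0 i)) (flat 0)) => //.
  rewrite (_ : (fun _ => _) = cst (r - a 0 i) \+ (fun x : 'rV[R]_m => x 0 i)).
    apply: CkD => //; [exact: smooth_on_cst|exact: Ck_coord].
  by apply/funext => x /=; ring.
  exact: smooth_flat.
Qed.

Lemma bump_center m (a : 'rV[R]_m) r : 0 < r -> bump a r a != 0.
Proof.
move=> r0; apply/prodf_neq0 => i _; rewrite !subrr subr0 addr0 /flat r0.
by rewrite mulf_neq0// mulf_neq0 ?expf_neq0 ?invr_eq0 ?gt_eqF ?expR_gt0.
Qed.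

Lemma bump_support m (a : 'rV[R]_m) r x : bump a r x != 0 ->
  forall i, `|x 0 i - a 0 i| < r.
Proof.
move=> /prodf_neq0 bx i.
have := bx i isT; rewrite mulf_eq0 negb_or /flat.
case: ifPn; last by rewrite eqxx.
case: ifPn; last by rewrite eqxx andbF.
by move=> ? ? _; rewrite ltr_norml; lra.
Qed.

Lemma cube_ball m (a x : 'rV[R]_m) r e : 0 <= r -> r < e ->
  (forall i, `|x 0 i - a 0 i| <= r) -> ball a e x.
Proof.
move=> r0 re ax; rewrite -ball_normE /ball_/=; apply: le_lt_trans re.
rewrite {1}/Num.Def.normr/= mx_normrE bigmax_le//= => -[i j] _ /=.
by rewrite !mxE (ord1 i) distrC.
Qed.

End Bump.

(** * Hadamard's lemma *)

Section SegmentIntegral.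
Context {R : realType}.
Implicit Types (phi psi : R -> R) (t : R).

(** Continuity at the points of the segment as a function on the whole line:
    stronger than continuity on the segment, and stable under composition
    without subspace topologies. *)
Definition cont01 phi := forall t, t \in `[0, 1] -> {for t, continuous phi}.

Definition int01 phi : R := \int[lebesgue_measure]_(t in `[0, 1]) phi t.

Lemma cont01_within phi : cont01 phi -> {within `[0, 1], continuous phi}.
Proof.
move=> cphi; apply: continuous_in_subspaceT => t; rewrite inE/= => t01.
exact: cphi.
Qed.

Lemma cont01_integrable phi : cont01 phi ->
  (@lebesgue_measure R).-integrable `[0, 1] (EFin \o phi).
Proof.
move=> cphi; apply: continuous_compact_integrable.
  exact: segment_compact.
exact: cont01_within.
Qed.

Lemma int01D phi psi : cont01 phi -> cont01 psi ->
  int01 (phi \+ psi) = int01 phi + int01 psi.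
Proof.
by move=> cphi cpsi; rewrite /int01 RintegralD//; exact: cont01_integrable.
Qed.

Lemma int01B phi psi : cont01 phi -> cont01 psi ->
  int01 (phi \- psi) = int01 phi - int01 psi.
Proof.
by move=> cphi cpsi; rewrite /int01 RintegralB//; exact: cont01_integrable.
Qed.

Lemma int01Z phi a : cont01 phi -> int01 (cst a \* phi) = a * int01 phi.
Proof. by move=> cphi; rewrite /int01 RintegralZl//; exact: cont01_integrable. Qed.

Lemma cont01Z phi a : cont01 phi -> cont01 (cst a \* phi).
Proof. by move=> cphi t t01; apply: cvgM; [exact: cvg_cst|exact: cphi]. Qed.

Lemma cont01_sum n (phi : 'I_n -> R -> R) : (forall i, cont01 (phi i)) ->
  cont01 (\sum_i phi i).
Proof.
elim: n phi => [|n IHn] phi cphi.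
  by rewrite big_ord0 => t _; exact: cst_continuous.
rewrite big_ord_recl => t t01; apply: cvgD; first exact: cphi.
exact: (IHn (fun i => phi (lift ord0 i))).
Qed.

Lemma eq_int01 phi psi : {in `[0, 1], phi =1 psi} -> int01 phi = int01 psi.
Proof. by move=> e; apply: eq_Rintegral => t; rewrite inE/= => /e. Qed.

Lemma int01_cst a : int01 (cst a) = a.
Proof.
rewrite /int01 Rintegral_cst//=; rewrite lebesgue_measure_itv/= lte_fin ltr01.
by rewrite oppr0 addr0 mulr1.
Qed.

Lemma int01_sum n (phi : 'I_n -> R -> R) : (forall i, cont01 (phi i)) ->
  int01 (\sum_i phi i) = \sum_i int01 (phi i).
Proof.
elim: n phi => [|n IHn] phi cphi; first by rewrite !big_ord0; exact: int01_cst.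
rewrite !big_ord_recl -IHn//.
by apply: int01D; [exact: cphi|exact: cont01_sum].
Qed.

Lemma int01_bound phi e : cont01 phi -> (forall t, t \in `[0, 1] -> `|phi t| <= e) ->
  `|int01 phi| <= e.
Proof.
move=> cphi be.
have ci := cont01_integrable cphi.
apply: (le_trans (le_normr_Rintegral _ ci)) => //.
rewrite -[leRHS](int01_cst e); apply: le_Rintegral => //.
- have /= := integrable_norm ci; exact.
- by apply: cont01_integrable => t _; exact: cst_continuous.
Qed.

Lemma int01_FTC (F : R -> R) phi : cont01 phi ->
  (forall t, t \in `[0, 1] -> is_derive t (1 : R) F (phi t)) ->
  int01 phi = F 1 - F 0.
Proof.
move=> cphi dF.
have cF t : t \in `[0, 1] -> {for t, continuous F}.
  move=> /dF [dt _]; apply: differentiable_continuous.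
  exact/derivable1_diffP.
rewrite /int01 /Rintegral (@continuous_FTC2 _ _ F) ?ltr01//.
- exact: cont01_within.
- split.
  + by move=> t /subset_itv_oo_cc/dF [].
  + by apply: cvg_at_right_filter; apply: cF; rewrite in_itv/= lexx ler01.
  + by apply: cvg_at_left_filter; apply: cF; rewrite in_itv/= lexx ler01.
- move=> t /subset_itv_oo_cc/dF dt; rewrite derive1E.
  by rewrite derive_val.
Qed.

End SegmentIntegral.

(** The little-o form of differentiability unfolded into an estimate, with a
    candidate for the differential. *)
Lemma differentiable_expansion {R : realType} (V W : normedModType R) (f : V -> W)
    (L : {linear V -> W}) (x : V) : continuous L ->
  (forall e, 0 < e -> \forall h \near (0 : V), `|f (x + h) - f x - L h| <= e * `|h|) ->
  differentiable f x /\ 'd f x = L :> (V -> W).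
Proof.
move=> cL fL.
have ef : f \o shift x = cst (f x) + L +o_ 0 id.
  apply/eqaddoP => e e0; apply: filterS (fL e e0) => h.
  by rewrite !fctE /= (addrC h) opprD addrA.
have dE := diff_unique cL ef.
by split => //; apply/diff_locallyP; rewrite dE.
Qed.

Section Hadamard.
Context {R : realType} {m : nat}.
Variables (U : set 'rV[R]_m) (q : 'rV[R]_m).
Implicit Types (f : 'rV[R]_m -> R) (t s : R).
Hypothesis oU : open U.
Definition ray (t : R) (x : 'rV[R]_m) := q + t *: (x - q).
Hypothesis starU : forall (t : R) x, t \in `[0, 1] -> U x -> U (ray t x).

Lemma ray1 x : ray 1 x = x. Proof. by rewrite /ray scale1r addrC subrK. Qed.
Lemma ray0 x : ray 0 x = q. Proof. by rewrite /ray scale0r addr0. Qed.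
Lemma ray_center t : ray t q = q. Proof. by rewrite /ray subrr scaler0 addr0. Qed.
Lemma rayD t x h : ray t (x + h) = ray t x + t *: h.
Proof. by rewrite /ray (addrAC x) scalerDr addrA. Qed.

(** The weights [t ^+ n] make the family stable under derivation in [x]: each
    derivative brings out a factor [t] from [ray t x]. *)
Definition moment n (f : 'rV[R]_m -> R) x := int01 (fun t => t ^+ n * f (ray t x)).

Lemma ray_continuous2 x t (h : 'rV[R]_m) :
  ray y.1 (x + y.2) @[y --> ((t, h) : R * 'rV[R]_m)] --> ray t (x + h).
Proof.
apply: (@cvgD _ _ _ _ _ (fun=> q)); first exact: cvg_cst.
apply: (@cvgZ _ _ _ _ _ fst (fun y => x + y.2 - q)); first exact: cvg_fst.
apply: (@cvgB _ _ _ _ _ (fun y => x + y.2) (fun=> q)); last exact: cvg_cst.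
by apply: (@cvgD _ _ _ _ _ (fun=> x)); [exact: cvg_cst|exact: cvg_snd].
Qed.

Lemma ray_continuous x : continuous (ray ^~ x).
Proof.
move=> t; apply: (@cvgD _ _ _ _ _ (fun=> q)); first exact: cvg_cst.
by apply: cvgZr_tmp; exact: cvg_id.
Qed.

Lemma cont_ray f x : Ck 0 U f -> U x -> cont01 (fun t => f (ray t x)).
Proof.
move=> cf Ux t t01; apply: (@continuous_comp _ _ _ (ray ^~ x) f).
  exact: ray_continuous.
by apply: cf; exact: starU.
Qed.

Lemma cont_mono n phi : cont01 phi -> cont01 (fun t : R => t ^+ n * phi t).
Proof.
move=> cphi t t01; apply: cvgM; last exact: cphi.
exact: exprn_continuous.
Qed.

(** The segment is compact, so the continuity of [f] along it is uniform. *)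
Lemma ray_unif f x (e : R) : Ck 0 U f -> U x -> 0 < e ->
  \forall h \near (0 : 'rV[R]_m),
    forall t, t \in `[0, 1] -> `|f (ray t (x + h)) - f (ray t x)| < e.
Proof.
move=> cf Ux e0.
have := iffLR (compact_near_coveringP _) (@segment_compact R 0 1).
move=> /(_ _ (nbhs (0 : 'rV[R]_m)) (fun h t => `|f (ray t (x + h)) - f (ray t x)| < e)).
apply => t /= t01.
have e20 : 0 < e / 2 by rewrite divr_gt0.
have cft : {for ray t x, continuous f} by apply: cf; exact: starU.
have c2 : f (ray y.1 (x + y.2)) @[y --> ((t, 0) : R * 'rV[R]_m)] --> f (ray t x).
  apply: continuous_cvg => //.
  by rewrite -[X in _ --> ray t X](addr0 x); exact: ray_continuous2.
have c1 : f (ray y.1 x) @[y --> ((t, 0) : R * 'rV[R]_m)] --> f (ray t x).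
  apply: continuous_cvg => //.
  apply: (@continuous_cvg _ _ _ _ _ fst (ray ^~ x)); last exact: cvg_fst.
  exact: ray_continuous.
move/cvgrPdist_lt : c2 => /(_ _ e20) c2.
move/cvgrPdist_lt : c1 => /(_ _ e20) c1.
apply: filterS (filterI c1 c2) => -[t' h] /= [h1 h2].
rewrite (splitr e) -(subrKA (f (ray t x))) (le_lt_trans (ler_normD _ _))//.
by rewrite ltrD// distrC.
Qed.

Lemma norm_mono n (t a e : R) : t \in `[0, 1] -> `|a| <= e -> `|t ^+ n * a| <= e.
Proof.
rewrite in_itv/= => /andP[t0 t1] ae; rewrite normrM normrX ger0_norm//.
by apply: le_trans ae; rewrite ler_piMl// exprn_ile1.
Qed.

Lemma moment_continuous n f : Ck 0 U f -> Ck 0 U (moment n f).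
Proof.
move=> cf x Ux;
apply: (iffRL (@cvgrPdist_le _ _ _ (nbhs x) (nbhs_filter x) _ _)) => e e0.
have Ux' : \forall y \near x, U y by exact: open_nbhs_nbhs.
have := ray_unif cf Ux e0; rewrite (near_shift x) sub0r => uf.
apply: filterS2 uf Ux' => y /= uf Uy.
have yE : x + (y - x) = y by rewrite addrC subrK.
rewrite distrC /moment -int01B; [|exact/cont_mono/cont_ray..].
apply: int01_bound.
  move=> t t01; apply: cvgB; exact/cont_mono/t01/cont_ray.
move=> t t01; rewrite /= -mulrBr norm_mono// ltW//.
by have := uf t t01; rewrite yE.
Qed.

Definition row_form (c v : 'rV[R]_m) : R := \sum_i v 0 i * c 0 i.
Fact row_form_linear c : linear (row_form c).
Proof.
move=> a u v; rewrite /row_form scaler_sumr -big_split; apply: eq_bigr => i _ /=.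
by rewrite !mxE mulrDl /GRing.scale/= mulrA.
Qed.
HB.instance Definition _ c :=
  GRing.isLinear.Build R 'rV[R]_m R _ (row_form c) (row_form_linear c).

Lemma row_form_continuous c : continuous (row_form c).
Proof.
have : Ck 0 setT (\sum_i ((fun v : 'rV[R]_m => v 0 i) \* cst (c 0 i))).
  apply: Ck_sum => [|i]; first exact: openT.
  apply: CkM; [exact: openT|exact: Ck_coord openT|].
  exact: smooth_on_cst openT _.
rewrite (_ : \sum_i _ = row_form c) => [C v|]; first exact: C.
by apply/funext => v; rewrite fct_sumE.
Qed.

Lemma is_derive_line f (y w : 'rV[R]_m) s : differentiable f (y + s *: w) ->
  is_derive s (1 : R) (fun s => f (y + s *: w)) ('D_w f (y + s *: w)).
Proof.
move=> /(@diff_derivable _ _ _ _ _ w) dw.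
have E : (fun h : R => h^-1 *: (((fun s => f (y + s *: w)) \o shift s) (h *: 1)
                                - f (y + s *: w))) =
  (fun h : R => h^-1 *: ((f \o shift (y + s *: w)) (h *: w) - f (y + s *: w))).
  by apply/funext => h; rewrite /= [h *: 1]mulr1 scalerDl addrCA.
by apply: DeriveDef; rewrite /derivable /derive E.
Qed.

Lemma mvt_segment f (y w : 'rV[R]_m) :
  (forall s, s \in `[0, 1] -> differentiable f (y + s *: w)) ->
  exists2 s, s \in `[0, 1] & f (y + w) - f y = 'D_w f (y + s *: w).
Proof.
move=> df.
pose F (s : R) : R := f (y + s *: w); pose dF (s : R) : R := 'D_w f (y + s *: w).
have dfs s : s \in `[0, 1] -> is_derive s (1 : R) F (dF s).
  by move=> /df; exact: is_derive_line.
have cF : {within `[0, 1], continuous F}.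
  apply: cont01_within => s /dfs [ds _].
  exact/differentiable_continuous/derivable1_diffP.
have dF01 s : s \in `]0, 1[ -> is_derive s (1 : R) F (dF s).
  by move=> /subset_itv_oo_cc/dfs.
have [s s01] := MVT_segment ler01 dF01 cF.
by rewrite /F scale1r scale0r addr0 subr0 mulr1 => E; exists s.
Qed.

Lemma norm_coord (h : 'rV[R]_m) i : `|h 0 i| <= `|h|.
Proof.
rewrite [leRHS]/Num.Def.normr/= mx_normrE.
exact: (le_bigmax _ (fun k : 'I_1 * 'I_m => `|h k.1 k.2|) (0, i)).
Qed.

(** Differentiation under the integral sign. The mean value theorem along the
    short segment from [ray t x] to [ray t (x + h)] turns the remainder into
    differences of partial derivatives of [f], and these are small uniformly in
    [t] by [ray_unif]. *)
Lemma moment_diff n f x : (forall y, U y -> differentiable f y) ->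
  (forall v, Ck 0 U ('D_v f)) -> U x ->
  differentiable (moment n f) x /\
  forall v, 'D_v (moment n f) x = moment n.+1 ('D_v f) x.
Proof.
move=> df Df Ux.
have cf : Ck 0 U f by move=> y /df; exact: differentiable_continuous.
pose c : 'rV[R]_m := \row_j moment n.+1 ('D_(delta_mx 0 j) f) x.
have cd v y : U y -> cont01 (fun t => 'D_v f (ray t y)) by exact: cont_ray (Df v).
have row_formE h : row_form c h = int01 (fun t => t ^+ n * (t * 'D_h f (ray t x))).
  rewrite (@eq_int01 _ _ (\sum_j (cst (h 0 j) \*
      (fun t => t ^+ n.+1 * 'D_(delta_mx 0 j) f (ray t x))))); last first.
    move=> t t01; rewrite fct_sumE (deriveE_coord _ (df _ (starU t01 Ux))) !mulr_sumr.
    by apply: eq_bigr => j _ /=; rewrite exprS; ring.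
  rewrite int01_sum => [|j]; last by apply/cont01Z/cont_mono/cd.
  apply: eq_bigr => j _; rewrite int01Z; last exact/cont_mono/cd.
  by rewrite mxE.
have [dm dmE] : differentiable (moment n f) x /\
    'd (moment n f) x = row_form c :> ('rV[R]_m -> R).
  apply: differentiable_expansion; first exact: row_form_continuous.
  move=> e e0.
  (* m + 1 rather than m keeps the quotient meaningful in dimension 0 *)
  have e'0 : 0 < e / m.+1%:R by rewrite divr_gt0.
  have [d /= d0 Hd] : exists2 d : R, 0 < d & forall h : 'rV[R]_m, `|h| < d ->
     U (x + h) /\ forall (j : 'I_m) t, t \in `[0, 1] ->
      `|'D_(delta_mx 0 j) f (ray t (x + h)) - 'D_(delta_mx 0 j) f (ray t x)| <
      e / m.+1%:R.
    have uf : \forall h \near (0 : 'rV[R]_m), forall (j : 'I_m) t, t \in `[0, 1] ->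
        `|'D_(delta_mx 0 j) f (ray t (x + h)) - 'D_(delta_mx 0 j) f (ray t x)| <
        e / m.+1%:R.
      have := @filter_forall _ 'I_m (fun j h => forall t, t \in `[0, 1] ->
        `|'D_(delta_mx 0 j) f (ray t (x + h)) - 'D_(delta_mx 0 j) f (ray t x)| <
        e / m.+1%:R) (nbhs (0 : 'rV[R]_m)) (nbhs_filter _).
      by apply=> j; exact: ray_unif (Df _) Ux e'0.
    have Uxh : \forall h \near (0 : 'rV[R]_m), U (x + h).
      have : \forall y \near x, U y by exact: open_nbhs_nbhs.
      rewrite (near_shift 0) subr0; apply: filterS => h /=.
      by rewrite addrC.
    have [d d0 Hd] := iffLR (nbhs_ballP _ _) (filterI Uxh uf).
    exists d => // h hd; apply: Hd.
    by rewrite -ball_normE/= sub0r normrN.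
  apply: (iffRL (nbhs_ballP _ _)); exists d => // h; rewrite -ball_normE/= sub0r normrN => hd.
  have shd s : s \in `[0, 1] -> `|s *: h| < d.
    rewrite in_itv/= normrZ => /andP[s0 s1]; rewrite ger0_norm//.
    by apply: le_lt_trans hd; rewrite ler_piMl.
  have [Uh _] := Hd h hd.
  have cth v : cont01 (fun t => t * 'D_v f (ray t x)).
    by have /= := @cont_mono 1%N _ (cd v x Ux); exact.
  have c1 : cont01 (fun t => t ^+ n * f (ray t (x + h)) - t ^+ n * f (ray t x)).
    by move=> t t01; apply: cvgB; exact/cont_mono/t01/cont_ray.
  have c2 : cont01 (fun t => t ^+ n * (t * 'D_h f (ray t x))) by exact: cont_mono.
  rewrite row_formE /moment -int01B; [|exact/cont_mono/cont_ray..].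
  rewrite -int01B//.
  apply: int01_bound.
    by move=> t t01; apply: cvgB; [exact: c1|exact: c2].
  move=> t t01 /=; rewrite -!mulrBr norm_mono// rayD.
  have Us s : s \in `[0, 1] -> U (ray t x + s *: (t *: h)).
    move=> s01; rewrite scalerA mulrC -scalerA -rayD; apply: starU => //.
    by have [] := Hd _ (shd s s01).
  have [s s01 ->] := mvt_segment (fun s s01 => df _ (Us s s01)).
  have Ux' : U (ray t x) by exact: starU.
  rewrite (deriveE_coord _ (df _ (Us s s01))) (deriveE_coord _ (df _ Ux')).
  rewrite mulr_sumr -sumrB.
  apply: (@le_trans _ _ (\sum_(i < m) (e / m.+1%:R * `|h|))); last first.
    rewrite sumr_const card_ord -[leLHS]mulr_natr mulrAC ler_wpM2r//.
    rewrite mulrAC -mulrA ler_piMr//; first exact: ltW.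
    by rewrite ler_pdivrMr// mul1r ler_nat.
  apply: le_trans (ler_norm_sum _ _ _) _; apply: ler_sum => i _.
  rewrite mxE mulrA -mulrBr normrM mulrC ler_pM//.
    rewrite scalerA mulrC -scalerA -rayD ltW//.
    by have [_] := Hd _ (shd s s01); exact.
  apply: le_trans (norm_coord h i); rewrite normrM ler_piMl//.
  by move: t01; rewrite in_itv/= => /andP[? ?]; rewrite ger0_norm.
split=> // v; rewrite deriveE// dmE row_formE; apply: eq_int01 => t _.
by rewrite exprS mulrCA mulrA.
Qed.

Lemma Ck_moment k n f : Ck k U f -> Ck k U (moment n f).
Proof.
elim: k n f => [|k IHk] n f; first exact: moment_continuous.
move=> [df Df]; have Df0 v : Ck 0 U ('D_v f) by exact: Ck_le (Df v).
split=> [x Ux|v]; first by have [] := moment_diff n df Df0 Ux.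
apply: Ck_eq (IHk n.+1 _ (Df v)) => // x Ux.
by have [_ ->] := moment_diff n df Df0 Ux.
Qed.

(** The fundamental theorem of calculus along the segment from [q] to [x]. The
    point is that the cofactors of the [x 0 j - q 0 j] are smooth. *)
Lemma hadamard f x : Ck 1 U f -> U x ->
  f x = f q + \sum_j (x 0 j - q 0 j) * moment 0 ('D_(delta_mx 0 j) f) x.
Proof.
move=> [df Df] Ux.
have cD v : cont01 (fun t => 'D_v f (ray t x)) by exact: cont_ray (Df v) Ux.
apply/eqP; rewrite addrC -subr_eq; apply/eqP.
have <- : int01 (fun t => 'D_(x - q) f (ray t x)) = f x - f q.
  rewrite -[X in f X - _]ray1 -[X in _ - f X](ray0 x).
  apply: (@int01_FTC _ (fun t => f (ray t x))) => // t t01.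
  by apply: is_derive_line; exact/df/starU.
rewrite (@eq_int01 _ _ (\sum_j (cst ((x - q) 0 j) \*
    (fun t => t ^+ 0 * 'D_(delta_mx 0 j) f (ray t x))))); last first.
  move=> t t01; rewrite fct_sumE (deriveE_coord _ (df _ (starU t01 Ux))).
  by apply: eq_bigr => j _ /=; rewrite expr0 mul1r.
rewrite int01_sum => [|j]; last by apply/cont01Z/cont_mono/cD.
apply: eq_bigr => j _; rewrite int01Z; last exact/cont_mono/cD.
by rewrite !mxE.
Qed.

Lemma moment_center f : moment 0 f q = f q.
Proof.
rewrite -[RHS]int01_cst; apply: eq_int01 => t _.
by rewrite ray_center expr0 mul1r.
Qed.

End Hadamard.

(** * Local frames of vector fields *)

Section ChartBump.
Context {R : realType} {d : nat}.
Variable M : manifold R d.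
Variables (c : chart R d M) (a : 'rV[R]_d) (r : R).
Hypotheses (ac : atlas c) (r0 : 0 < r) (Uc : ball a (r *+ 2) `<=` ccod c).
Let U := ball a (r *+ 2).

Let oU : open U. Proof. exact: ball_open. Qed.

(** A function read in the chart, cut off by the bump and extended by 0 to the
    whole manifold. *)
Definition bump_ext (u : 'rV[R]_d -> R) (p : M) : R :=
  if `[< cdom c p >] then bump a r (cto c p) * u (cto c p) else 0.

Lemma bump_ext_in u p : cdom c p -> bump_ext u p = bump a r (cto c p) * u (cto c p).
Proof. by move=> cp; rewrite /bump_ext asboolT. Qed.

Lemma bump_ext_out u p : ~ cdom c p -> bump_ext u p = 0.
Proof. by move=> cp; rewrite /bump_ext asboolF. Qed.

Lemma bump_in_U x : bump a r x != 0 -> U x.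
Proof.
move=> /bump_support bx; apply: (@cube_ball _ _ _ _ r); first exact: ltW.
  by rewrite mulr2n ltrDl.
by move=> i; exact: ltW.
Qed.

Let K : set 'rV[R]_d := [set x | forall i, x 0 i \in `[a 0 i - r, a 0 i + r]].

Let KU : K `<=` U.
Proof.
move=> x Kx; apply: (@cube_ball _ _ _ _ r); first exact: ltW.
  by rewrite mulr2n ltrDl.
by move=> i; have := Kx i; rewrite in_itv/= ler_norml; lra.
Qed.

Let bumpK x : bump a r x != 0 -> K x.
Proof.
by move=> /bump_support bx i; have := bx i; rewrite in_itv/= ltr_norml; lra.
Qed.

Let closedK : closed (cfrom c @` K).
Proof.
apply: compact_closed; first exact: mhausdorff.
apply: continuous_compact.
  apply: continuous_in_subspaceT => x; rewrite inE => /KU/Uc.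
  exact: cfrom_continuous.
apply: (@rV_compact R d (fun i => `[a 0 i - r, a 0 i + r]%classic)) => i.
exact: segment_compact.
Qed.

Lemma open_chart_preimage (c' : chart R d M) (O : set M) :
  open O -> open (ccod c' `&` cfrom c' @^-1` O).
Proof.
move=> oO; rewrite openE => x [cx Ox].
apply: filterI; first by apply: open_nbhs_nbhs; split => //; exact: ccod_open.
by apply: cfrom_continuous => //; exact: open_nbhs_nbhs.
Qed.

(** Two open sets cover the manifold: the part of the chart above [U], where the
    function is a composition of smooth maps, and the complement of the compact
    set [cfrom c @` K], where it vanishes. That complement is open because the
    manifold is Hausdorff. *)
Lemma bump_ext_smooth u : smooth_on U u -> smooth_fun (bump_ext u).
Proof.
move=> su c' ac' k; apply: Ck_local => x cx.
have [[cp Up]|np] := pselect (cdom c (cfrom c' x) /\ U (cto c (cfrom c' x))).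
- pose W := ccod c' `&` cfrom c' @^-1` cdom c `&` (cto c \o cfrom c') @^-1` U.
  have Ck' : Ck k (ccod c' `&` cfrom c' @^-1` cdom c) (cto c \o cfrom c').
    exact: atlas_compatible.
  have oW0 := open_chart_preimage (c' := c') (cdom_open c).
  have oW : open W.
    rewrite openE => y [yW0 Uy]; apply: filterI; first exact: open_nbhs_nbhs.
    have cy : {for y, continuous (cto c \o cfrom c')}.
      have C1 : Ck 0 (ccod c' `&` cfrom c' @^-1` cdom c) (cto c \o cfrom c').
        exact: atlas_compatible.
      exact: C1.
    by apply: cy; exact: open_nbhs_nbhs.
  exists W => //.
  apply: (@Ck_eq _ _ _ k W ((bump a r \* u) \o (cto c \o cfrom c'))) => //.
    by move=> y [[_ cy] _] /=; rewrite bump_ext_in.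
  apply: (@Ck_comp _ _ _ _ W U) => //; first by move=> y [].
    by apply: Ck_sub Ck'; move=> y [].
  by apply: CkM => //; apply: Ck_sub (smooth_bump a r k).
- exists (ccod c' `&` cfrom c' @^-1` (~` (cfrom c @` K))).
    split => // -[y Ky yx]; apply: np; have Uy := KU Ky.
    rewrite -yx; split; first by apply: cfrom_dom; exact: Uc.
    by rewrite cfromK//; exact: Uc.
  have oW : open (ccod c' `&` cfrom c' @^-1` (~` (cfrom c @` K))).
    by apply: open_chart_preimage; exact: closed_openC closedK.
  apply: (@Ck_eq _ _ _ k _ (cst 0)) => //; last exact: smooth_on_cst.
  move=> y [_ nK] /=; have [cy|cy] := pselect (cdom c (cfrom c' y)); last first.
    by rewrite bump_ext_out.
  rewrite bump_ext_in//; have [->|/bumpK Ky] := eqVneq (bump a r (cto c (cfrom c' y))) 0.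
    by rewrite mul0r.
  by exfalso; apply: nK; exists (cto c (cfrom c' y)) => //; rewrite ctoK.
Qed.

Lemma smooth_U (f : cinf M) : smooth_on U (f \o cfrom c).
Proof. by move=> k; apply: Ck_sub (cinf_smooth f ac k). Qed.

Let smooth_pder (f : cinf M) i :
  smooth_on U ('D_(delta_mx 0 i) (f \o cfrom c)).
Proof. exact/smooth_derive/smooth_U. Qed.

Lemma pder_derivation i p :
  derivation_at p (fun f : cinf M => bump_ext ('D_(delta_mx 0 i) (f \o cfrom c)) p).
Proof.
have [cp|cp] := pselect (cdom c p); last first.
  by split=> [b f h|f h]; rewrite !bump_ext_out// !mulr0 ?addr0.
have df (f : cinf M) : derivable (f \o cfrom c) (cto c p) (delta_mx 0 i).
  apply: diff_derivable; apply: (smooth_diff (cinf_smooth f ac)).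
  exact: cto_cod.
have fE (f : cinf M) : f p = (f \o cfrom c) (cto c p) by rewrite /= ctoK.
split=> [b f h|f h]; rewrite !bump_ext_in//.
  rewrite (_ : (b *: f + h : cinf M) \o cfrom c =
               b *: (f \o cfrom c) + (h \o cfrom c))//.
  rewrite deriveD//; last exact: derivableZ.
  by rewrite deriveZ// /GRing.scale/=; ring.
rewrite (_ : (f * h : cinf M) \o cfrom c = (f \o cfrom c) * (h \o cfrom c))//.
by rewrite deriveM// !fE /GRing.scale/=; ring.
Qed.

Definition pder_tangent i p : tangent p := to_tangent (pder_derivation i p).

Lemma pder_smooth i (f : cinf M) : smooth_fun (fun p => pder_tangent i p f).
Proof. exact/bump_ext_smooth/smooth_pder. Qed.

Definition bump_pder i : vfield M := VField (pder_smooth i).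

Definition bumpM : cinf M := to_cinf (bump_ext_smooth (@smooth_on_cst R 'rV[R]_d R _ 1 oU)).

Let smooth_coord i : smooth_on U (fun x : 'rV[R]_d => x 0 i).
Proof. by move=> k; exact: Ck_coord. Qed.
Definition coordM i : cinf M := to_cinf (bump_ext_smooth (smooth_coord i)).

Lemma bumpM_out p : ~ cdom c p -> bumpM p = 0.
Proof. exact: bump_ext_out. Qed.

Lemma bumpM_in p : cdom c p -> bumpM p = bump a r (cto c p).
Proof. by move=> cp; rewrite /= bump_ext_in// mulr1. Qed.

Lemma bump_ext_eq0 u p : bumpM p = 0 -> bump_ext u p = 0.
Proof.
have [cp|cp] := pselect (cdom c p); last by rewrite bump_ext_out.
by rewrite bumpM_in// bump_ext_in// => ->; rewrite mul0r.
Qed.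

Lemma bumpM_neq0 p : bumpM p != 0 -> cdom c p /\ U (cto c p).
Proof.
have [cp|/bumpM_out ->] := pselect (cdom c p); last by rewrite eqxx.
by rewrite bumpM_in// => /bump_in_U.
Qed.

Lemma U_star q : U q -> forall t x, t \in `[0, 1] -> U x -> U (ray q t x).
Proof.
rewrite /U -ball_normE /ball_/= => qU t x; rewrite in_itv/= => /andP[t0 t1] xU.
have -> : a - ray q t x = (1 - t) *: (a - q) + t *: (a - x).
  apply/rowP => i; rewrite !mxE; ring.
apply: le_lt_trans (ler_normD _ _) _; rewrite !normrZ !ger0_norm ?subr_ge0//.
have [->|tN0] := eqVneq t 0; first by rewrite subr0 mul1r mul0r addr0.
have t_gt0 : 0 < t by rewrite lt_neqAle eq_sym tN0.
have : (1 - t) * `|a - q| <= (1 - t) * (r *+ 2).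
  by rewrite ler_wpM2l ?subr_ge0// ltW.
have : t * `|a - x| < t * (r *+ 2) by rewrite ltr_pM2l.
by lra.
Qed.

Lemma tangentD (p : M) (v : tangent p) (f h : cinf M) : v (f + h) = v f + v h.
Proof. by rewrite -[f]scale1r tangent_lin mul1r scale1r. Qed.

Lemma tangent0 (p : M) (v : tangent p) : v 0 = 0.
Proof. by apply: (addrI (v 0)); rewrite -tangentD !addr0. Qed.

Lemma tangentZ (p : M) (v : tangent p) b (f : cinf M) : v (b *: f) = b * v f.
Proof. by rewrite -[b *: f]addr0 tangent_lin tangent0 addr0. Qed.

Lemma tangent_sum (p : M) (v : tangent p) n (F : 'I_n -> cinf M) :
  v (\sum_i F i) = \sum_i v (F i).
Proof. exact: (big_morph v (tangentD v) (tangent0 v)). Qed.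

Lemma cinf_sumE n (F : 'I_n -> cinf M) (p : M) : (\sum_i F i) p = \sum_i F i p.
Proof. exact: (big_morph (fun f : cinf M => f p)). Qed.

(** Write q for the coordinates of [p]. Hadamard's lemma at q, multiplied by two
    bumps so that all factors become globally smooth, expresses b^2 f as
    f(p) b^2 + sum_i (b x_i - q_i b) (b g_i), where g_i(q) is the i-th partial
    derivative of f at q. Both sides can be fed to the derivation [v], and the
    Leibniz rule leaves the formula, because b x_i - q_i b vanishes at [p]. The
    third bump factor makes the coefficients smooth functions of [p] when [v] is
    the value of a vector field. *)
Lemma frame_expansion (p : M) (v : tangent p) :
  bumpM p ^+ 3 *: v =
  \sum_i (bumpM p * v (coordM i) - coordM i p * v bumpM) *: bump_pder i p.
Proof.
apply/val_inj/funext => f.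
have sumE n (F : 'I_n -> tangent p) : (\sum_i F i) f = \sum_i F i f.
  exact: (big_morph (fun w : tangent p => w f)).
rewrite /= sumE.
transitivity (\sum_i (bumpM p * v (coordM i) - coordM i p * v bumpM) * bump_pder i p f); last first.
  by [].
transitivity (bumpM p ^+ 3 * v f) => //.
have [b0|bN0] := eqVneq (bumpM p) 0.
  rewrite b0 expr0n mul0r big1// => i _.
  by rewrite [bump_pder i p f](bump_ext_eq0 _ b0) mulr0.
have [cp Up] := bumpM_neq0 bN0.
set q := cto c p in Up *.
pose g i : cinf M := to_cinf (bump_ext_smooth
  (fun k => Ck_moment oU (U_star Up) 0 (smooth_pder f i k))).
have id : bumpM * bumpM * f = f p *: (bumpM * bumpM) +
    \sum_i (coordM i - q 0 i *: bumpM) * g i.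
  apply/val_inj/funext => x.
  have -> : val (bumpM * bumpM * f) x = bumpM x * bumpM x * f x by [].
  have -> : val (f p *: (bumpM * bumpM) + \sum_i (coordM i - q 0 i *: bumpM) * g i) x =
      f p * (bumpM x * bumpM x) + \sum_i (coordM i x - q 0 i * bumpM x) * g i x.
    by rewrite -[in RHS](cinf_sumE (fun i => (coordM i - q 0 i *: bumpM) * g i)).
  have [x0|xN0] := eqVneq (bumpM x) 0.
    rewrite x0 !mul0r mulr0 big1 ?addr0// => i _.
    by rewrite [g i x](bump_ext_eq0 _ x0) mulr0.
  have [cx Ux] := bumpM_neq0 xN0.
  have -> : f x = (f \o cfrom c) (cto c x) by rewrite /= ctoK.
  rewrite (hadamard (U_star Up) (smooth_U f 1%N) Ux).
  rewrite /= ctoK// mulrDr mulrC; congr (_ + _).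
  rewrite mulr_sumr; apply: eq_bigr => i _; rewrite !bump_ext_in//=; ring.
have gp i : g i p = bump_pder i p f.
  by rewrite /g /= !bump_ext_in// moment_center.
have coordE i : coordM i p = q 0 i * bumpM p by rewrite /= !bump_ext_in//=; ring.
have := congr1 v id.
rewrite !tangent_leibniz !tangentD tangentZ tangent_leibniz tangent_sum.
have -> : (bumpM * bumpM) p = bumpM p * bumpM p by [].
under eq_bigr => i _.
  rewrite tangent_leibniz.
  have -> : (coordM i - q 0 i *: bumpM) p = coordM i p - q 0 i * bumpM p by [].
  rewrite coordE subrr mul0r add0r gp.
  have -> : v (coordM i - q 0 i *: bumpM) = v (coordM i) - q 0 i * v bumpM.
    by rewrite -scaleNr tangentD tangentZ mulNr.
  over.
rewrite [LHS]addrC => /addrI E.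
rewrite exprS -mulrA expr2 E mulr_sumr; apply: eq_bigr => i _.
by rewrite coordE; ring.
Qed.

End ChartBump.

(** * Vector fields through a tangent vector, and tensoriality *)

Section Tensoriality.
Context {R : realType} {d : nat}.
Variable M : manifold R d.

Lemma local_frame (p : M) :
  exists (b : cinf M) (x : 'I_d -> cinf M) (F : 'I_d -> vfield M),
    b p != 0 /\ forall (q : M) (v : tangent q),
      b q ^+ 3 *: v = \sum_i (b q * v (x i) - x i q * v b) *: F i q.
Proof.
have [c ac cp] := atlas_cover p.
have : nbhs (cto c p) (ccod c).
  apply: open_nbhs_nbhs; split; first exact: ccod_open.
  exact: cto_cod.
move=> /nbhs_ballP[e /= e0 Uc].
have r0 : 0 < e / 2 by rewrite divr_gt0.
have Uc' : ball (cto c p) (e / 2 *+ 2) `<=` ccod c.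
  by rewrite -mulr_natr mulfVK ?pnatr_eq0.
exists (bumpM ac r0 Uc'), (coordM ac r0 Uc'), (bump_pder ac r0 Uc'); split.
  by rewrite bumpM_in// bump_center.
by move=> q v; exact: frame_expansion.
Qed.

Lemma vfield_ext (X Y : vfield M) : (forall p, X p = Y p) -> X = Y.
Proof.
case: X Y => [X sX] [Y sY] /= XY.
have E : X = Y by apply: functional_extensionality_dep.
by case: _ / E sY => sY; congr VField; exact: Prop_irrelevance.
Qed.

Definition vf_sum n (F : 'I_n -> vfield M) : vfield M :=
  \big[@vf_add R d M / vf0 M]_i F i.

Lemma vf_sumE n (F : 'I_n -> vfield M) p : vf_sum F p = \sum_i F i p.
Proof. exact: (big_morph (fun X : vfield M => X p)). Qed.

(** Freeze the coefficients of the frame expansion at [p]. *)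
Lemma extend_exists (p : M) (v : tangent p) : exists X : vfield M, X p = v.
Proof.
have [b [x [F [bp fr]]]] := local_frame p.
pose s := (b p ^+ 3)^-1.
pose k i : cinf M := to_cinf (smooth_cst (s * (b p * v (x i) - x i p * v b))).
exists (vf_sum (fun i => vf_scale (k i) (F i))); rewrite vf_sumE.
transitivity (s *: (b p ^+ 3 *: v)).
  by rewrite fr scaler_sumr; apply: eq_bigr => i _; rewrite scalerA.
by rewrite scalerA mulVf ?scale1r// expf_neq0.
Qed.

Lemma extendE (p : M) (v : tangent p) : extend v p = v.
Proof.
have [X Xv] := extend_exists v.
exact: (@xgetPex _ (vf0 M) [set X : vfield M | X p = v] (ex_intro _ X Xv)).
Qed.

(** Multiplying a field by b^3 makes it a global combination of the frame
    fields, with coefficients whose values at [p] depend only on the value of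
    the field at [p]. *)
Lemma tensorial (p : M) (T : lmodType R) (L : vfield M -> T) :
  (forall X Y, L (vf_add X Y) = L X + L Y) ->
  (forall (f : cinf M) X, L (vf_scale f X) = f p *: L X) ->
  forall X Y : vfield M, X p = Y p -> L X = L Y.
Proof.
move=> LD LZ.
have L0 : L (vf0 M) = 0.
  have E : vf0 M = vf_scale 0 (vf0 M).
    by apply: vfield_ext => q; rewrite -[RHS]/(0 *: 0) scale0r.
  by rewrite E LZ scale0r.
have [b [x [F [bp fr]]]] := local_frame p.
pose a (X : vfield M) i : cinf M := b * vf_app X (x i) - x i * vf_app X b.
have LE X : b p ^+ 3 *: L X = \sum_i a X i p *: L (F i).
  rewrite -[_ *: _](LZ (b ^+ 3)).
  have -> : vf_scale (b ^+ 3) X = vf_sum (fun i => vf_scale (a X i) (F i)).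
    apply: vfield_ext => q; rewrite vf_sumE; exact: fr.
  rewrite (big_morph L LD L0); apply: eq_bigr => i _.
  by rewrite LZ.
move=> X Y XY; apply: (scalerI (expf_neq0 3 bp)); rewrite !LE.
apply: eq_bigr => i _; congr (_ *: _).
by rewrite -[LHS]/(b p * X p (x i) - x i p * X p b) XY.
Qed.

End Tensoriality.

(** * Curvature of a Levi-Civita connection *)

Section Curvature.
Context {R : realType} {d : nat}.
Variable M : manifold R d.
Variables (g : metric M) (nabla : connection M).
Implicit Types (p : M) (X Y Z W : vfield M) (f : cinf M).

Lemma tangent_ext p (u v : tangent p) : (forall f, u f = v f) -> u = v.
Proof. by move=> uv; apply/val_inj/funext. Qed.

Lemma tevD p (u v : tangent p) f : (u + v) f = u f + v f. Proof. by []. Qed.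
Lemma tevN p (u : tangent p) f : (- u) f = - u f. Proof. by []. Qed.
Lemma tevZ p a (u : tangent p) f : (a *: u) f = a * u f. Proof. by []. Qed.
Lemma tev0 p f : (0 : tangent p) f = 0. Proof. by []. Qed.
Definition tevE := (tevD, tevN, tevZ, tev0).

Lemma tangentN p (v : tangent p) f : v (- f) = - v f.
Proof. by rewrite -scaleN1r tangentZ mulN1r. Qed.

Lemma cnD p (u v : tangent p) Y : nabla p (u + v) Y = nabla p u Y + nabla p v Y.
Proof. by rewrite -[u]scale1r cn_lin !scale1r. Qed.

Lemma cn0 p Y : nabla p 0 Y = 0.
Proof. by apply: (addrI (nabla p 0 Y)); rewrite -cnD !addr0. Qed.

Lemma cnZ p a (u : tangent p) Y : nabla p (a *: u) Y = a *: nabla p u Y.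
Proof. by rewrite -[a *: u]addr0 cn_lin cn0 addr0. Qed.

Lemma cnN p (u : tangent p) Y : nabla p (- u) Y = - nabla p u Y.
Proof. by rewrite -scaleN1r cnZ scaleN1r. Qed.

Lemma curvE X Y Z p : curv nabla X Y Z p =
  nabla p (X p) (cn_app nabla Y Z) - nabla p (Y p) (cn_app nabla X Z)
  - nabla p (bracket X Y p) Z.
Proof. by []. Qed.

Lemma bracketE X Y p f : bracket X Y p f = X p (vf_app Y f) - Y p (vf_app X f).
Proof. by []. Qed.

Lemma bracket_antisym X Y p : bracket X Y p = - bracket Y X p.
Proof. by apply: tangent_ext => f; rewrite tevE !bracketE opprB. Qed.

Lemma curv_antisym X Y Z p : curv nabla X Y Z p = - curv nabla Y X Z p.
Proof.
rewrite !curvE (bracket_antisym X) cnN; apply: tangent_ext => f; rewrite !tevE.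
by ring.
Qed.

Lemma curvDl X X' Y Z p :
  curv nabla (vf_add X X') Y Z p = curv nabla X Y Z p + curv nabla X' Y Z p.
Proof.
have E W : cn_app nabla (vf_add X X') W =
    vf_add (cn_app nabla X W) (cn_app nabla X' W).
  by apply: vfield_ext => q; exact: cnD.
have B : bracket (vf_add X X') Y p = bracket X Y p + bracket X' Y p.
  apply: tangent_ext => f; rewrite tevE !bracketE.
  have -> : vf_app (vf_add X X') f = vf_app X f + vf_app X' f by exact: val_inj.
  by rewrite tangentD tevE; ring.
rewrite !curvE E B cn_add !cnD; apply: tangent_ext => f; rewrite !tevE.
by ring.
Qed.

Lemma curvZl h X Y Z p :
  curv nabla (vf_scale h X) Y Z p = h p *: curv nabla X Y Z p.
Proof.
have E W : cn_app nabla (vf_scale h X) W = vf_scale h (cn_app nabla X W).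
  by apply: vfield_ext => q; exact: cnZ.
have B : bracket (vf_scale h X) Y p = h p *: bracket X Y p - Y p h *: X p.
  apply: tangent_ext => f; rewrite !tevE !bracketE.
  have -> : vf_app (vf_scale h X) f = h * vf_app X f by exact: val_inj.
  by rewrite tangent_leibniz tevE /=; ring.
rewrite !curvE E B cn_leibniz !cnD !cnN !cnZ; apply: tangent_ext => f.
by rewrite !tevE; ring.
Qed.

Lemma curvDr X Y Z Z' p :
  curv nabla X Y (vf_add Z Z') p = curv nabla X Y Z p + curv nabla X Y Z' p.
Proof.
have E W : cn_app nabla W (vf_add Z Z') =
    vf_add (cn_app nabla W Z) (cn_app nabla W Z').
  by apply: vfield_ext => q; exact: cn_add.
rewrite !curvE !E !cn_add; apply: tangent_ext => f; rewrite !tevE.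
by ring.
Qed.

Lemma curvZr h X Y Z p :
  curv nabla X Y (vf_scale h Z) p = h p *: curv nabla X Y Z p.
Proof.
have E W : cn_app nabla W (vf_scale h Z) =
    vf_add (vf_scale (vf_app W h) Z) (vf_scale h (cn_app nabla W Z)).
  by apply: vfield_ext => q; exact: cn_leibniz.
rewrite !curvE !E !cn_add !cn_leibniz bracketE; apply: tangent_ext => f.
by rewrite !tevE /=; ring.
Qed.

(** The curvature is linear over smooth functions in each argument, hence
    tensorial; this gives a meaning to [Riem], which picks extensions. *)
Lemma curv_pointwise p X X' Y Y' Z Z' : X p = X' p -> Y p = Y' p -> Z p = Z' p ->
  curv nabla X Y Z p = curv nabla X' Y' Z' p.
Proof.
have tX (V V' W W' : vfield M) : V p = V' p -> curv nabla V W W' p = curv nabla V' W W' p.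
  apply: (@tensorial _ _ _ p _ (fun X => curv nabla X W W' p)).
    by move=> *; exact: curvDl.
  by move=> *; exact: curvZl.
have tZ (W W' V V' : vfield M) : V p = V' p -> curv nabla W W' V p = curv nabla W W' V' p.
  apply: (@tensorial _ _ _ p _ (fun Z => curv nabla W W' Z p)).
    by move=> *; exact: curvDr.
  by move=> *; exact: curvZr.
move=> hX hY hZ; rewrite (tX _ _ _ _ hX) (tZ _ _ _ _ hZ).
by rewrite curv_antisym (tX _ _ _ _ hY) -curv_antisym.
Qed.

Lemma RiemE X Y Z p : Riem nabla (X p) (Y p) (Z p) = curv nabla X Y Z p.
Proof. by apply: curv_pointwise; exact: extendE. Qed.

Lemma gmD p (u v w : tangent p) : g p (u + v) w = g p u w + g p v w.
Proof. by rewrite -[u]scale1r gm_lin mul1r scale1r. Qed.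

Lemma gm0 p (w : tangent p) : g p 0 w = 0.
Proof. by apply: (addrI (g p 0 w)); rewrite -gmD !addr0. Qed.

Lemma gmZ p a (u w : tangent p) : g p (a *: u) w = a * g p u w.
Proof. by rewrite -[a *: u]addr0 gm_lin gm0 addr0. Qed.

Lemma gmN p (u w : tangent p) : g p (- u) w = - g p u w.
Proof. by rewrite -scaleN1r gmZ mulN1r. Qed.

Lemma gmDr p (u v w : tangent p) : g p w (u + v) = g p w u + g p w v.
Proof. by rewrite !(gm_sym g w) gmD. Qed.

Lemma gmZr p a (u w : tangent p) : g p w (a *: u) = a * g p w u.
Proof. by rewrite !(gm_sym g w) gmZ. Qed.

Lemma gmNr p (u w : tangent p) : g p w (- u) = - g p w u.
Proof. by rewrite !(gm_sym g w) gmN. Qed.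

Definition gmE := (gmD, gmN, gmZ, gmDr, gmNr, gmZr).

Lemma gm_eq0 p (u : tangent p) : (forall w, g p u w = 0) -> u = 0.
Proof.
by move=> u0; apply/eqP; apply: contraT => /(gm_pos g); rewrite u0 ltxx.
Qed.

Hypothesis hLC : levi_civita g nabla.

Lemma torsion_free X Y p : nabla p (X p) Y = nabla p (Y p) X + bracket X Y p.
Proof. by rewrite -hLC.1 addrCA subrr addr0. Qed.

Lemma metric_compatible p (v : tangent p) Y Z :
  v (gm_app g Y Z) = g p (nabla p v Y) (Z p) + g p (Y p) (nabla p v Z).
Proof. exact: hLC.2. Qed.

(** Torsion-freeness turns the cyclic sum into the Jacobi identity. *)
Lemma curv_bianchi X Y Z p :
  curv nabla X Y Z p + curv nabla Y Z X p + curv nabla Z X Y p = 0.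
Proof.
have tf V W : cn_app nabla V W = vf_add (cn_app nabla W V) (bracket V W).
  by apply: vfield_ext => q; exact: torsion_free.
rewrite !curvE (tf Y Z) (tf Z X) (tf X Y) !cn_add.
rewrite (torsion_free X (bracket Y Z)) (torsion_free Y (bracket Z X)).
rewrite (torsion_free Z (bracket X Y)).
apply: tangent_ext => f; rewrite !tevE !bracketE.
have E V W : vf_app (bracket V W) f = vf_app V (vf_app W f) - vf_app W (vf_app V f).
  exact: val_inj.
by rewrite !E !tangentD !tangentN; ring.
Qed.

(** The curvature operator acts on the function g(Z, W) as X Y - Y X - [X, Y],
    that is, as 0, and metric compatibility distributes it over Z and W. *)
Lemma curv_skew X Y Z W p :
  g p (curv nabla X Y Z p) (W p) = - g p (Z p) (curv nabla X Y W p).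
Proof.
have E V : vf_app V (gm_app g Z W) =
    gm_app g (cn_app nabla V Z) W + gm_app g Z (cn_app nabla V W).
  by apply/val_inj/funext => q; exact: metric_compatible.
have := bracketE X Y p (gm_app g Z W).
rewrite metric_compatible !E !tangentD !metric_compatible !curvE !gmE /=.
move=> H; apply/eqP; rewrite -addr_eq0; apply/eqP.
by lra.
Qed.

Lemma Riem_antisym p (u v w : tangent p) : Riem nabla u v w = - Riem nabla v u w.
Proof. exact: curv_antisym. Qed.

Lemma Riem_bianchi p (u v w : tangent p) :
  Riem nabla u v w + Riem nabla v w u + Riem nabla w u v = 0.
Proof. exact: curv_bianchi. Qed.

Lemma Riem_skew p (u v w z : tangent p) :
  g p (Riem nabla u v w) z = - g p (Riem nabla u v z) w.
Proof.
have [W <-] := extend_exists z; have [Z <-] := extend_exists w.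
have [Y <-] := extend_exists v; have [X <-] := extend_exists u.
by rewrite !RiemE curv_skew gm_sym.
Qed.

Lemma RiemDl p (u u' v w : tangent p) :
  Riem nabla (u + u') v w = Riem nabla u v w + Riem nabla u' v w.
Proof.
rewrite /Riem -curvDl; apply: curv_pointwise => //.
by rewrite extendE /= !extendE.
Qed.

Lemma RiemZl p a (u v w : tangent p) :
  Riem nabla (a *: u) v w = a *: Riem nabla u v w.
Proof.
have := curvZl (to_cinf (smooth_cst a)) (extend u) (extend v) (extend w) p.
rewrite /Riem /= => <-; apply: curv_pointwise => //.
by rewrite extendE /= !extendE.
Qed.

End Curvature.

(** * Contact metric and Sasakian identities *)

Section Sasakian.
Context {R : realType} {d : nat}.
Variable M : manifold R d.
Variables (phi : endofield M) (xi : vfield M) (eta : oneform M) (g : metric M).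
Variable nabla : connection M.
Implicit Types (p : M) (X Y Z W : vfield M) (f : cinf M).

Lemma efD p (u v : tangent p) : phi p (u + v) = phi p u + phi p v.
Proof. by rewrite -[u]scale1r ef_lin !scale1r. Qed.

Lemma ef0 p : phi p 0 = 0.
Proof. by apply: (addrI (phi p 0)); rewrite -efD !addr0. Qed.

Lemma efZ p a (u : tangent p) : phi p (a *: u) = a *: phi p u.
Proof. by rewrite -[a *: u]addr0 ef_lin ef0 addr0. Qed.

Lemma efN p (u : tangent p) : phi p (- u) = - phi p u.
Proof. by rewrite -scaleN1r efZ scaleN1r. Qed.

Definition efE := (efD, efN, efZ).

Lemma ofD p (u v : tangent p) : eta p (u + v) = eta p u + eta p v.
Proof. by rewrite -[u]scale1r of_lin mul1r scale1r. Qed.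

Lemma of0 p : eta p 0 = 0.
Proof. by apply: (addrI (eta p 0)); rewrite -ofD !addr0. Qed.

Lemma ofZ p a (u : tangent p) : eta p (a *: u) = a * eta p u.
Proof. by rewrite -[a *: u]addr0 of_lin of0 addr0. Qed.

Lemma ofN p (u : tangent p) : eta p (- u) = - eta p u.
Proof. by rewrite -scaleN1r ofZ mulN1r. Qed.

Section Contact.
Hypothesis hC : contact_metric phi xi eta g.

Lemma phi_sq p (u : tangent p) : phi p (phi p u) = - u + eta p u *: xi p.
Proof. by have [] := hC. Qed.

Lemma eta_xi p : eta p (xi p) = 1.
Proof. by have [] := hC. Qed.

Lemma gm_phi p (u v : tangent p) :
  g p (phi p u) (phi p v) = g p u v - eta p u * eta p v.
Proof. by have [] := hC. Qed.

Lemma xi_neq0 p : xi p != 0.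
Proof.
by apply/eqP => x0; have := eta_xi p; rewrite x0 of0 => /esym/eqP; rewrite oner_eq0.
Qed.

(** Compare the two readings of the third power of [phi]. *)
Lemma eta_phi_xi p (u : tangent p) : eta p (phi p u) *: xi p = eta p u *: phi p (xi p).
Proof.
apply: (addrI (- phi p u)); rewrite -phi_sq (phi_sq u).
by rewrite !efE.
Qed.

(** The previous lemma makes the value of [phi] at the characteristic vector a
    multiple e of that vector; [phi_sq] then gives e^2 = 0. *)
Lemma phi_xi p : phi p (xi p) = 0.
Proof.
have [e E] : exists e, phi p (xi p) = e *: xi p.
  by exists (eta p (phi p (xi p))); rewrite eta_phi_xi eta_xi scale1r.
have := phi_sq (xi p); rewrite eta_xi scale1r addNr E efZ E scalerA => /eqP.
rewrite scaler_eq0 (negbTE (xi_neq0 p)) orbF mulf_eq0 orbb => /eqP ->.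
by rewrite scale0r.
Qed.

Lemma gm_xi p (u : tangent p) : g p u (xi p) = eta p u.
Proof.
have := gm_phi u (xi p); rewrite phi_xi gm_sym gm0 eta_xi mulr1 => /esym/eqP.
by rewrite subr_eq0 => /eqP.
Qed.

(** The form [dform eta] is alternating. *)
Lemma phi_skew p (u v : tangent p) : g p u (phi p v) = - g p (phi p u) v.
Proof.
have [X <-] := extend_exists u; have [Y <-] := extend_exists v.
have [_ _ _ hd] := hC; rewrite (gm_sym g (phi p _)) !hd /dform.
by rewrite (bracket_antisym Y) ofN; ring.
Qed.

End Contact.

Hypothesis hLC : levi_civita g nabla.
Hypothesis hS : sasakian phi xi eta g nabla.
Let hC := hS.1.

Lemma cn_phi p (v : tangent p) Y : nabla p v (ef_app phi Y) =
  phi p (nabla p v Y) + (g p v (Y p) *: xi p - eta p (Y p) *: v).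
Proof.
by have [X <-] := extend_exists v; rewrite -hS.2 addrC subrK.
Qed.

Lemma tangent1 p (v : tangent p) : v 1 = 0.
Proof.
have := tangent_leibniz v 1 1.
rewrite mulr1 -[(1 : cinf M) p]/1 mul1r => /eqP; rewrite -subr_eq0 opprD addrA subrr.
by rewrite sub0r oppr_eq0 => /eqP.
Qed.

(** Differentiate [phi] xi = 0: the Sasakian identity then determines the image
    under [phi] of the derivative of xi, and its component along xi is 0 because
    xi has constant length. *)
Lemma cn_xi p (v : tangent p) : nabla p v xi = - phi p v.
Proof.
have e1 : eta p (nabla p v xi) = 0.
  have := metric_compatible hLC v xi xi.
  have -> : gm_app g xi xi = to_cinf (smooth_cst 1).
    by apply/val_inj/funext => q; rewrite /= gm_xi// eta_xi.
  have -> : to_cinf (smooth_cst 1) = (1 : cinf M) by exact: val_inj.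
  rewrite tangent1.
  by rewrite (gm_sym g (xi p)) gm_xi//; lra.
have := cn_phi v xi.
have -> : ef_app phi xi = vf0 M by apply: vfield_ext => q; exact: phi_xi.
have -> : nabla p v (vf0 M) = 0.
  have := cn_add nabla v (vf0 M) (vf0 M).
  have -> : vf_add (vf0 M) (vf0 M) = vf0 M by apply: vfield_ext => q; exact: addr0.
  by move=> H; apply: (addrI (nabla p v (vf0 M))); rewrite -H addr0.
rewrite gm_xi// eta_xi// scale1r => /(congr1 (phi p)).
rewrite ef0 !efE phi_xi// scaler0 add0r phi_sq// e1 scale0r addr0.
by move/eqP; rewrite eq_sym subr_eq0 => /eqP <-; rewrite opprK.
Qed.

(** Differentiate the Sasakian identity once more and antisymmetrize. The right
    side is the same commutator formed with the curvature of the unit sphere,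
    so that the difference of the two curvatures commutes with [phi]. *)
Lemma curv_phi X Y Z p :
  curv nabla X Y (ef_app phi Z) p - phi p (curv nabla X Y Z p) =
  - g p (Y p) (Z p) *: phi p (X p) + g p (X p) (Z p) *: phi p (Y p)
  + g p (Z p) (phi p (X p)) *: Y p - g p (Z p) (phi p (Y p)) *: X p.
Proof.
have F V W : cn_app nabla V (ef_app phi W) =
    vf_add (ef_app phi (cn_app nabla V W))
      (vf_add (vf_scale (gm_app g V W) xi) (vf_scale (- of_app eta W) V)).
  by apply: vfield_ext => q; rewrite [LHS]cn_phi /= -scaleNr.
have etaE W : of_app eta W = gm_app g W xi.
  by apply/val_inj/funext => q; rewrite /= gm_xi.
rewrite !curvE !F !cn_add !cn_leibniz !cn_phi etaE !tangentN.
rewrite !(metric_compatible hLC) !cn_xi (torsion_free hLC X Y) !gmE.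
rewrite !efE !gm_xi//.
apply: tangent_ext => f; rewrite !tevE /=.
have -> : (- (fun q => g q (Z q) (xi q))) p = - eta p (Z p) by rewrite -(gm_xi hC).
ring.
Qed.

Lemma curv_xi X Y p :
  curv nabla X Y xi p = eta p (Y p) *: X p - eta p (X p) *: Y p.
Proof.
have F V : cn_app nabla V xi = vf_scale (- 1) (ef_app phi V).
  apply: vfield_ext => q; rewrite [LHS]cn_xi -[RHS]/((- 1) *: phi q (V q)).
  by rewrite scaleN1r.
rewrite curvE !F !cn_leibniz !cn_phi cn_xi (torsion_free hLC X Y) !tangentN !tangent1.
rewrite !efE (gm_sym g (Y p)).
have -> : (-1 : cinf M) p = -1 by [].
apply: tangent_ext => f; rewrite !tevE /=.
ring.
Qed.

Lemma Riem_phi p (u v w : tangent p) :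
  Riem nabla u v (phi p w) - phi p (Riem nabla u v w) =
  - g p v w *: phi p u + g p u w *: phi p v
  + g p w (phi p u) *: v - g p w (phi p v) *: u.
Proof.
have [X <-] := extend_exists u; have [Y <-] := extend_exists v.
have [Z <-] := extend_exists w; rewrite -curv_phi -RiemE -RiemE.
by [].
Qed.

Lemma Riem_xi p (u v : tangent p) :
  Riem nabla u v (xi p) = eta p v *: u - eta p u *: v.
Proof.
have [X <-] := extend_exists u; have [Y <-] := extend_exists v.
by rewrite RiemE curv_xi.
Qed.

End Sasakian.

(** * Curvature-like tensors *)

Section CurvatureLike.
Context {R : realType} {T : lmodType R}.
Variable S : T -> T -> T -> T -> R.
Hypothesis SD1 : forall x x' y z w, S (x + x') y z w = S x y z w + S x' y z w.
Hypothesis SZ1 : forall a x y z w, S (a *: x) y z w = a * S x y z w.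
Hypothesis S12 : forall x y z w, S x y z w = - S y x z w.
Hypothesis S34 : forall x y z w, S x y z w = - S x y w z.
Hypothesis Sbianchi : forall x y z w, S x y z w + S y z x w + S z x y w = 0.

(** The alternating sum of the Bianchi identity over the four cyclic shifts of
    (x, y, z, w). *)
Lemma S_pair x y z w : S x y z w = S z w x y.
Proof.
have := Sbianchi x y z w; have := Sbianchi y z w x.
have := Sbianchi z w x y; have := Sbianchi w x y z.
have := S34 y z x w; have := S34 z w y x; have := S34 w x z y; have := S34 x y w z.
have := S12 x z w y; have := S34 z x w y; have := S12 w y z x; have := S34 y w z x.
by lra.
Qed.

Lemma SD2 x y y' z w : S x (y + y') z w = S x y z w + S x y' z w.
Proof. by rewrite S12 SD1 opprD -!S12. Qed.
Lemma SD3 x y z z' w : S x y (z + z') w = S x y z w + S x y z' w.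
Proof. by rewrite S_pair SD1 !(S_pair _ w). Qed.
Lemma SD4 x y z w w' : S x y z (w + w') = S x y z w + S x y z w'.
Proof. by rewrite S34 SD3 opprD -!S34. Qed.
Lemma SZ2 a x y z w : S x (a *: y) z w = a * S x y z w.
Proof. by rewrite S12 SZ1 -mulrN -S12. Qed.
Lemma SZ3 a x y z w : S x y (a *: z) w = a * S x y z w.
Proof. by rewrite S_pair SZ1 (S_pair _ w). Qed.
Lemma SZ4 a x y z w : S x y z (a *: w) = a * S x y z w.
Proof. by rewrite S34 SZ3 -mulrN -S34. Qed.
Definition S_lin := (SD1, SD2, SD3, SD4, SZ1, SZ2, SZ3, SZ4).

(** Polarization makes [S] alternating in the second and fourth slots, hence in
    all slots; then the Bianchi identity reads 3 S = 0. *)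
Lemma sectional_zero : (forall x y, S x y x y = 0) ->
  forall x y z w, S x y z w = 0.
Proof.
move=> S0.
have S1 x y z : S x y z y = 0.
  have := S0 (x + z) y; rewrite !S_lin !S0 (S_pair z); lra.
move=> x y z w; have E a b c e : S a b c e = - S a e c b.
  by have := S1 a (b + e) c; rewrite !S_lin !S1; lra.
have := S12 y z x w; have := S_pair z y x w; have := E x y z w.
have := E z x y w; have := S_pair z w y x; have := S12 y x z w.
have := Sbianchi x y z w; lra.
Qed.

Variables (phi : T -> T) (eta : T -> R) (xi : T).
Hypothesis phiD : forall x y, phi (x + y) = phi x + phi y.
Hypothesis phiZ : forall a x, phi (a *: x) = a *: phi x.
Hypothesis phi2 : forall x, phi (phi x) = - x + eta x *: xi.
Hypothesis phixi : phi xi = 0.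
Hypothesis Sphi : forall x y z w, S x y (phi z) (phi w) = S x y z w.
Hypothesis Sxi : forall x y z, S x y z xi = 0.

(** The numerator of the [phi]-sectional curvature. *)
Definition holsec x := S x (phi x) (phi x) x.

Lemma holsecZ a x : holsec (a *: x) = a ^+ 4 * holsec x.
Proof. by rewrite /holsec !phiZ !S_lin; ring. Qed.

Let Sxi3 x y w : S x y xi w = 0. Proof. by rewrite S34 Sxi oppr0. Qed.
Let Sxi1 y z w : S xi y z w = 0. Proof. by rewrite S_pair Sxi3. Qed.
Let Sxi2 x z w : S x xi z w = 0. Proof. by rewrite S_pair Sxi. Qed.

Lemma holsec_xi a x : holsec (x + a *: xi) = holsec x.
Proof.
rewrite /holsec !phiD !phiZ !phixi scaler0 addr0 !S_lin !Sxi1 !Sxi.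
by rewrite !(mulr0, addr0).
Qed.

(** The argument that holomorphic sectional curvature determines a Kaehler
    curvature tensor. The form P(x, y, z, w) = S(x, phi y, z, phi w) is symmetric
    in x, y and in z, w, and under exchange of the two pairs, and it vanishes on
    the diagonal; so P(x, x, y, y) = - 2 P(x, y, x, y). The Bianchi identity gives
    P(x, x, y, y) = P(x, y, x, y) + S(x, y, x, y), and S(x, y, x, y) equals
    A(phi y) for A(y) = P(x, y, x, y). Hence A(phi y) = - 3 A(y). Applied twice
    this gives A = 9 A, since A(phi (phi y)) = A(y), and so S(x, y, x, y) = 0. *)
Lemma holsec_zero : (forall x, holsec x = 0) -> forall x y z w, S x y z w = 0.
Proof.
move=> H0; apply: sectional_zero.
have SN2 x y z w : S x (- y) z w = - S x y z w by rewrite -scaleN1r S_lin mulN1r.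
have SN4 x y z w : S x y z (- w) = - S x y z w by rewrite -scaleN1r S_lin mulN1r.
have SN1 x y z w : S (- x) y z w = - S x y z w by rewrite -scaleN1r S_lin mulN1r.
have SN3 x y z w : S x y (- z) w = - S x y z w by rewrite -scaleN1r S_lin mulN1r.
pose P x y z w := S x (phi y) z (phi w).
have phi1 x y z w : S (phi x) (phi y) z w = S x y z w.
  by rewrite S_pair Sphi S_pair.
have P12 x y z w : P x y z w = P y x z w.
  by rewrite /P -phi1 phi2 !S_lin SN2 Sxi2 mulr0 addr0 (S12 y).
have Ppair x y z w : P x y z w = P z w x y by rewrite /P S_pair.
have P34 x y z w : P x y z w = P x y w z by rewrite Ppair P12 Ppair.
have PD1 x x' y z w : P (x + x') y z w = P x y z w + P x' y z w by exact: SD1.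
have PN1 x y z w : P (- x) y z w = - P x y z w by exact: SN1.
have PD2 x x' y z w : P y (x + x') z w = P y x z w + P y x' z w.
  by rewrite P12 PD1 !(P12 y).
have PN2 x y z w : P y (- x) z w = - P y x z w by rewrite P12 PN1 (P12 y).
have PD3 x x' y z w : P z w (x + x') y = P z w x y + P z w x' y.
  by rewrite Ppair PD1 !(Ppair z).
have PN3 x y z w : P z w (- x) y = - P z w x y by rewrite Ppair PN1 (Ppair z).
have PD4 x x' y z w : P z w y (x + x') = P z w y x + P z w y x'.
  by rewrite Ppair PD2 !(Ppair z).
have PN4 x y z w : P z w y (- x) = - P z w y x by rewrite Ppair PN2 (Ppair z).
have P0 x : P x x x x = 0 by rewrite /P S34 -[RHS]oppr0 -(H0 x).
(* the coefficient of t^2 in P at the four equal arguments x + t y *)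
have pol x y : P x x y y = - (2 * P x y x y).
  have := P0 (x + y); have := P0 (x - y).
  rewrite !(PD1, PD2, PD3, PD4, PN1, PN2, PN3, PN4) !P0.
  rewrite (Ppair y y x x) (P34 x y y x) (P12 y x x y) (P12 y x y x) (P34 x y y x).
  by lra.
have bia x y : P x x y y = P x y x y + S x y x y.
  have := Sbianchi x (phi x) y (phi y).
  rewrite (S12 (phi x) y) (S12 y x) -/(P x x y y) -/(P y x x y) (P12 y x).
  by rewrite Sphi; lra.
have SA x y : S x y x y = P x (phi y) x (phi y).
  by rewrite /P !phi2 !S_lin SN2 SN4 !Sxi2 !Sxi !mulr0 !addr0 opprK.
have A3 x y : P x (phi y) x (phi y) = - (3 * P x y x y).
  by rewrite -SA; have := pol x y; rewrite bia; lra.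
have A9 x y : P x (phi (phi y)) x (phi (phi y)) = P x y x y.
  by rewrite -SA.
move=> x y; rewrite SA; have := A9 x y; rewrite !A3; lra.
Qed.

End CurvatureLike.

(** * Curvature of the space form *)

Section SpaceForm.
Context {R : realType} {d : nat}.
Variable M : manifold R d.
Variables (phi : endofield M) (xi : vfield M) (eta : oneform M) (g : metric M).
Variable nabla : connection M.
Hypothesis hLC : levi_civita g nabla.
Hypothesis hN : sasakian_space_form phi xi eta g nabla 1.
Let hS := hN.1.
Let hC := hS.1.

(** The difference of the curvature and of that of the unit sphere has the
    symmetries of a curvature tensor, commutes with [phi] and annihilates xi.
    Its [phi]-sectional curvature vanishes on unit vectors orthogonal to xi by
    assumption, hence on all vectors by homogeneity and because xi does not
    contribute; [holsec_zero] concludes. *)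
Lemma Riem_space_form p (u v w : tangent p) :
  Riem nabla u v w = g p v w *: u - g p u w *: v.
Proof.
pose Sv (u v w : tangent p) := Riem nabla u v w - (g p v w *: u - g p u w *: v).
pose S (u v w z : tangent p) := g p (Sv u v w) z.
have SE a b e f : S a b e f = g p (Riem nabla a b e) f -
    (g p b e * g p a f - g p a e * g p b f) by rewrite /S /Sv !gmE.
have SD x x' y z w' : S (x + x') y z w' = S x y z w' + S x' y z w'.
  by rewrite !SE RiemDl !gmE; ring.
have SZ a x y z w' : S (a *: x) y z w' = a * S x y z w'.
  by rewrite !SE RiemZl !gmE; ring.
have S12 x y z w' : S x y z w' = - S y x z w'.
  by rewrite !SE Riem_antisym !gmE; ring.
have S34 x y z w' : S x y z w' = - S x y w' z.
  by rewrite !SE (Riem_skew hLC); ring.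
have SB x y z w' : S x y z w' + S y z x w' + S z x y w' = 0.
  have := congr1 (fun t => g p t w') (Riem_bianchi hLC x y z).
  rewrite gm0 !SE !gmE (gm_sym g y x) (gm_sym g z x) (gm_sym g z y).
  by move=> H; lra.
have phiSv x y z : Sv x y (phi p z) = phi p (Sv x y z).
  have := Riem_phi hLC hS x y z; rewrite /Sv !efE !(phi_skew hC) => /eqP.
  rewrite subr_eq => /eqP ->; apply: tangent_ext => f.
  by rewrite !tevE !(gm_sym g (phi p z)) !(phi_skew hC); ring.
have Sxi3 x y : Sv x y (xi p) = 0.
  rewrite /Sv (Riem_xi hLC hS) !(gm_xi hC); apply: tangent_ext => f.
  by rewrite !tevE; ring.
have Sxi x y z : S x y z (xi p) = 0 by rewrite S34 /S Sxi3 gm0 oppr0.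
have Sphi x y z w' : S x y (phi p z) (phi p w') = S x y z w'.
  rewrite /S phiSv (gm_phi hC) -(gm_xi hC (Sv _ _ _)).
  by rewrite -[g p _ (xi p)]/(S x y z (xi p)) Sxi mul0r subr0.
suff S0 x y z w' : S x y z w' = 0.
  apply/eqP; rewrite -subr_eq0; apply/eqP; apply: (gm_eq0 (g := g)) => z.
  exact: S0.
apply: (holsec_zero SD SZ S12 S34 SB
  (phi_sq hC (p := p)) Sphi Sxi) => {x y z w'} x.
have phi0 : phi p (xi p) = 0 by exact: phi_xi hC p.
pose x' := x - eta p x *: xi p.
have -> : x = x' + eta p x *: xi p by rewrite subrK.
rewrite (holsec_xi SD SZ S12 S34 SB (@efD _ _ _ phi p) (@efZ _ _ _ phi p) phi0 Sxi).
have ex' : g p x' (xi p) = 0.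
  by rewrite (gm_xi hC) ofD ofN ofZ (eta_xi hC) mulr1 subrr.
clearbody x'.
have [->|x'N0] := eqVneq x' 0.
  by rewrite /holsec /S gm_sym gm0.
have gpos := gm_pos g x'N0.
set s := Num.sqrt (g p x' x').
have s0 : 0 < s by rewrite sqrtr_gt0.
have ssq : s ^+ 2 = g p x' x' by rewrite sqr_sqrtr// ltW.
have -> : x' = s *: (s^-1 *: x') by rewrite scalerA divff ?scale1r// gt_eqF.
rewrite (holsecZ SZ S12 S34 SB (@efZ _ _ _ phi p)).
set y := s^-1 *: x'.
have gyy : g p y y = 1 by rewrite gmZ gmZr -ssq; field; rewrite gt_eqF.
have gyxi : g p y (xi p) = 0 by rewrite gmZ ex' mulr0.
have := hN.2 p y gyy gyxi; rewrite /sectional.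
have gyp : g p y (phi p y) = 0.
  by have := phi_skew hC y y; rewrite (gm_sym g (phi p y)); lra.
rewrite (gm_phi hC) gyy gyp -(gm_xi hC) gyxi !mul0r expr0n subr0 subr0 mulr1 divr1.
move=> Ry; rewrite /holsec SE Ry (gm_phi hC) gyy gyp -(gm_xi hC) gyxi.
by ring.
Qed.

End SpaceForm.

(** * Frenet curves *)

Section Curves.
Context {R : realType} {d : nat}.
Variable M : manifold R d.
Variables (g : metric M) (nabla : connection M).
Variables (I : set R) (gamma : R -> M) (D : along gamma -> along gamma).
Hypothesis hI : open_interval I.
Hypothesis hD : covariant_derivative_along I nabla D.
Implicit Types (V W : along gamma) (h k : R -> R).

Let oI : open I. Proof. by case: hI. Qed.

Lemma smooth_on_congr (U W : normedModType R) (O : set U) (f h : U -> W) : open O ->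
  (forall x, O x -> f x = h x) -> smooth_on O f -> smooth_on O h.
Proof. by move=> oO fh sf n; exact: Ck_eq fh (sf n). Qed.

Lemma smooth_along_congr V W : (forall t, I t -> V t = W t) ->
  smooth_along I V -> smooth_along I W.
Proof.
move=> VW sV f; apply: (smooth_on_congr oI) (sV f) => t It.
by rewrite VW.
Qed.

Lemma smooth_alongD V W : smooth_along I V -> smooth_along I W ->
  smooth_along I (fun t => V t + W t).
Proof. by move=> sV sW f n; exact: CkD (sV f n) (sW f n). Qed.

Lemma smooth_alongZ h V : smooth_on I h -> smooth_along I V ->
  smooth_along I (fun t => h t *: V t).
Proof. by move=> sh sV f n; exact: CkM (sh n) (sV f n). Qed.

Lemma along_ext V W : (forall t, V t = W t) -> V = W.
Proof. by move=> VW; apply: functional_extensionality_dep. Qed.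

Lemma smooth_along0 : smooth_along I (fun t => (0 : tangent (gamma t))).
Proof. by move=> f; exact: smooth_on_cst. Qed.

(** The indicator function of the complement of [I] is smooth on [I], where it
    is 0, and multiplication by it leaves [V] unchanged; so the Leibniz rule
    gives 0 on [I]. This makes [D] local although it acts on fields that are
    defined on the whole line. *)
Lemma D_vanish V t : smooth_along I V -> (forall s, I s -> V s = 0) -> I t ->
  D V t = 0.
Proof.
move=> sV V0 It.
pose h (s : R) : R := if `[< I s >] then 0 else 1.
have h0 s : I s -> h s = 0 by move=> Is; rewrite /h asboolT.
have sh : smooth_on I h.
  apply: (smooth_on_congr oI) (smooth_on_cst 0 oI) => s Is.
  by rewrite h0.
have -> : V = (fun s => h s *: V s).
  apply: along_ext => s; have [Is|nIs] := pselect (I s).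
    by rewrite V0// scaler0.
  by rewrite /h asboolF// scale1r.
by rewrite (cda_leibniz hD sh sV It) V0// h0// scaler0 scale0r addr0.
Qed.

Lemma D_local V W t : smooth_along I V -> smooth_along I W ->
  (forall s, I s -> V s = W s) -> I t -> D V t = D W t.
Proof.
move=> sV sW VW It.
pose Z : along gamma := fun s => V s + (-1) *: W s.
have sZ : smooth_along I Z.
  apply: smooth_alongD => //; apply: (@smooth_alongZ (fun=> -1)) => //.
  exact: smooth_on_cst.
have -> : V = (fun s => W s + Z s).
  by apply: along_ext => s; rewrite /Z scaleN1r addrCA subrr addr0.
rewrite (cda_add hD sW sZ It) (D_vanish sZ) ?addr0// => s Is.
by rewrite /Z VW// scaleN1r subrr.
Qed.

Lemma DZ h V t : smooth_on I h -> smooth_along I V -> I t ->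
  D (fun s => h s *: V s) t = 'D_1 h t *: V t + h t *: D V t.
Proof. by move=> sh sV It; rewrite (cda_leibniz hD)// derive1E. Qed.

Lemma derive_locally_cst h (a t : R) : (forall s, I s -> h s = a) -> I t ->
  'D_1 h t = 0.
Proof.
move=> ha It; rewrite -(@derive_cst _ _ _ a t 1); apply: near_eq_derive.
by apply: filterS (open_nbhs_nbhs (conj oI It)) => s /ha.
Qed.

Lemma derive0_cst h : smooth_on I h -> (forall t, I t -> 'D_1 h t = 0) ->
  forall s t, I s -> I t -> h s = h t.
Proof.
move=> sh h0; have [_ iI _] := hI.
suff lt s t : I s -> I t -> s <= t -> h s = h t.
  by move=> s t Is It; have [/lt->|/ltW/lt->] := leP s t.
move=> Is It st.
have Ix x : x \in `[s, t] -> I x by rewrite in_itv/=; exact: iI.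
have dh x : x \in `[s, t] -> is_derive x (1 : R) h 0.
  move=> /Ix Ix'; apply: DeriveDef; last exact: h0.
  by apply: diff_derivable; exact: smooth_diff Ix'.
have ch : {within `[s, t], continuous h}.
  apply: continuous_in_subspaceT => x; rewrite inE/= => /Ix Ix'.
  exact/differentiable_continuous/(smooth_diff sh Ix').
have dh' x : x \in `]s, t[ -> is_derive x (1 : R) h (cst 0 x).
  by move=> /subset_itv_oo_cc/dh.
have [x _] := MVT_segment st dh' ch.
by rewrite mul0r => /eqP; rewrite subr_eq0 => /eqP.
Qed.

Section Frenet.
Variables (r : nat) (E : nat -> along gamma) (kappa : nat -> R -> R).
Hypothesis hE : frenet_frame I g D r E kappa.

(** Extended by 0 beyond the osculating order, so that the Frenet equations have
    the same form at every index and all orders are treated at once. *)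
Definition frame_ext (i : nat) : along gamma :=
  if (i <= r)%N then E i else fun t => 0.
Definition kappa_ext (i : nat) : R -> R := if (i < r)%N then kappa i else cst 0.

Lemma frame_ext_smooth i : (0 < i)%N -> smooth_along I (frame_ext i).
Proof.
move=> i0; rewrite /frame_ext; case: ifPn => ir; last exact: smooth_along0.
by apply: (ff_smooth hE); rewrite i0.
Qed.

Lemma kappa_ext_smooth i : (0 < i)%N -> smooth_on I (kappa_ext i).
Proof.
move=> i0; rewrite /kappa_ext; case: ifPn => ir; last exact: smooth_on_cst.
by apply: (ff_kappa_smooth hE); rewrite i0.
Qed.

Lemma order_gt0 : (0 < r)%N.
Proof. by have /andP[] := ff_order hE. Qed.

Lemma D_frame_ext1 t : I t -> D (frame_ext 1) t = kappa_ext 1 t *: frame_ext 2 t.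
Proof.
move=> It; rewrite /frame_ext order_gt0 (ff_frenet hE)//; last by rewrite order_gt0.
by rewrite /kappa_ext add0r; case: ifPn => //; rewrite scale0r.
Qed.

Lemma D_frame_extS i t : (0 < i)%N -> I t ->
  D (frame_ext i.+1) t = - kappa_ext i t *: frame_ext i t + kappa_ext i.+1 t *: frame_ext i.+2 t.
Proof.
move=> i0 It; rewrite /frame_ext /kappa_ext; have [ir|ri] := ltnP i r; last first.
  rewrite ltnNge (leq_trans ri)//= oppr0 !scale0r addr0.
  by apply: D_vanish => //; exact: smooth_along0.
rewrite (ff_frenet hE)//= (ltnW ir) ltnS i0.
by case: ifPn => //; rewrite scale0r.
Qed.

Lemma frame_ext_orthonormal i j t : (0 < i)%N -> (0 < j <= r)%N -> I t ->
  g (gamma t) (frame_ext i t) (frame_ext j t) = (i == j)%:R.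
Proof.
move=> i0 /andP[j0 jr] It; rewrite /frame_ext jr; case: ifPn => ir.
  by rewrite (ff_orthonormal hE) ?i0 ?j0.
rewrite gm0; case: eqVneq ir => // ->; by rewrite jr.
Qed.

Lemma frame_ext_velocity t : I t -> frame_ext 1 t = velocity gamma t.
Proof. by move=> It; rewrite /frame_ext order_gt0 (ff_tangent hE). Qed.

Lemma velocity_smooth : smooth_along I (velocity gamma).
Proof. exact: smooth_along_congr frame_ext_velocity (frame_ext_smooth _). Qed.

Lemma D_velocity t : I t -> D (velocity gamma) t = kappa_ext 1 t *: frame_ext 2 t.
Proof.
move=> It; rewrite -D_frame_ext1//; apply: D_local => //.
- exact: velocity_smooth.
- exact: frame_ext_smooth.
- by move=> s /frame_ext_velocity.
Qed.

Lemma DD_velocity t : I t -> D (D (velocity gamma)) t =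
  - kappa_ext 1 t ^+ 2 *: frame_ext 1 t +
  ('D_1 (kappa_ext 1) t *: frame_ext 2 t +
   (kappa_ext 1 t * kappa_ext 2 t) *: frame_ext 3 t).
Proof.
move=> It.
rewrite (@D_local _ (fun s => kappa_ext 1 s *: frame_ext 2 s))//; last 3 first.
- exact/(cda_smooth hD)/velocity_smooth.
- by apply: smooth_alongZ; [exact: kappa_ext_smooth|exact: frame_ext_smooth].
- exact: D_velocity.
rewrite DZ//; [|exact: kappa_ext_smooth|exact: frame_ext_smooth].
rewrite D_frame_extS//; apply: tangent_ext => f; rewrite !tevE; ring.
Qed.

Lemma smoothM_on h k : smooth_on I h -> smooth_on I k -> smooth_on I (fun t => h t * k t).
Proof. by move=> sh sk n; exact: CkM (sh n) (sk n). Qed.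

Lemma DDD_velocity t : I t -> D (D (D (velocity gamma))) t =
  - (3 * kappa_ext 1 t * 'D_1 (kappa_ext 1) t) *: frame_ext 1 t +
  (('D_1 ('D_1 (kappa_ext 1)) t - kappa_ext 1 t ^+ 3 -
    kappa_ext 1 t * kappa_ext 2 t ^+ 2) *: frame_ext 2 t +
  ((2 * 'D_1 (kappa_ext 1) t * kappa_ext 2 t +
    kappa_ext 1 t * 'D_1 (kappa_ext 2) t) *: frame_ext 3 t +
  (kappa_ext 1 t * kappa_ext 2 t * kappa_ext 3 t) *: frame_ext 4 t)).
Proof.
move=> It.
pose c1 : R -> R := fun t => (-1) * (kappa_ext 1 t * kappa_ext 1 t).
pose c3 : R -> R := fun t => kappa_ext 1 t * kappa_ext 2 t.
have s1 : smooth_on I (kappa_ext 1) by exact: kappa_ext_smooth.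
have s2 : smooth_on I (kappa_ext 2) by exact: kappa_ext_smooth.
have sc1 : smooth_on I c1.
  by apply: (@smoothM_on (fun=> -1)); [exact: smooth_on_cst|exact: smoothM_on].
have sc3 : smooth_on I c3 by exact: smoothM_on.
have sd1 : smooth_on I ('D_1 (kappa_ext 1)) by exact: smooth_derive.
have sf i : (0 < i)%N -> smooth_along I (frame_ext i) by exact: frame_ext_smooth.
have dv h : smooth_on I h -> derivable h t 1.
  by move=> sh; apply: diff_derivable; exact: smooth_diff It.
have dc3 : 'D_1 c3 t = kappa_ext 1 t * 'D_1 (kappa_ext 2) t + kappa_ext 2 t * 'D_1 (kappa_ext 1) t.
  by rewrite deriveM//; exact: dv.
have dc1 : 'D_1 c1 t = - (2 * kappa_ext 1 t * 'D_1 (kappa_ext 1) t).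
  rewrite (@deriveM _ _ (cst (-1)) (fun t => kappa_ext 1 t * kappa_ext 1 t)); last 2 first.
  - exact: derivable_cst.
  - by apply: dv; exact: smoothM_on.
  rewrite derive_cst deriveM; [|exact: dv..].
  by rewrite /GRing.scale/=; ring.
rewrite (@D_local _ (fun s => c1 s *: frame_ext 1 s +
    ('D_1 (kappa_ext 1) s *: frame_ext 2 s + c3 s *: frame_ext 3 s)))//; last 3 first.
- exact/(cda_smooth hD)/(cda_smooth hD)/velocity_smooth.
- apply: smooth_alongD; last apply: smooth_alongD.
  + by apply: smooth_alongZ => //; exact: sf.
  + by apply: smooth_alongZ => //; exact: sf.
  + by apply: smooth_alongZ => //; exact: sf.
- by move=> s Is; rewrite DD_velocity// /c1 mulN1r -expr2.
rewrite (cda_add hD)//; last 2 first.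
- by apply: smooth_alongZ => //; exact: sf.
- by apply: smooth_alongD; apply: smooth_alongZ => //; exact: sf.
rewrite (cda_add hD)//; last 2 first.
- by apply: smooth_alongZ => //; exact: sf.
- by apply: smooth_alongZ => //; exact: sf.
rewrite !DZ//; [|exact: sf..].
rewrite dc1 dc3 D_frame_ext1// !D_frame_extS//.
by apply: tangent_ext => f; rewrite !tevE /c1 /c3; ring.
Qed.

Hypothesis Riem1 : forall p (u v w : tangent p),
  Riem nabla u v w = g p v w *: u - g p u w *: v.

(** For curvature 1 the curvature term contributes the derivative of the unit
    tangent, hence the summand - 1 in the normal component. *)
Lemma bitensionE t : I t -> bitension nabla D t =
  - (3 * kappa_ext 1 t * 'D_1 (kappa_ext 1) t) *: frame_ext 1 t +
  (('D_1 ('D_1 (kappa_ext 1)) t -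
    kappa_ext 1 t * (kappa_ext 1 t ^+ 2 + kappa_ext 2 t ^+ 2 - 1)) *: frame_ext 2 t +
  ((2 * 'D_1 (kappa_ext 1) t * kappa_ext 2 t +
    kappa_ext 1 t * 'D_1 (kappa_ext 2) t) *: frame_ext 3 t +
  (kappa_ext 1 t * kappa_ext 2 t * kappa_ext 3 t) *: frame_ext 4 t)).
Proof.
move=> It; rewrite /bitension DDD_velocity// D_velocity// -frame_ext_velocity// Riem1.
have r1 : (0 < 1 <= r)%N by rewrite order_gt0.
rewrite !gmE !frame_ext_orthonormal//= mulr0 scale0r.
by apply: tangent_ext => f; rewrite !tevE; ring.
Qed.

Lemma geodesic_order1 : r = 1%N -> geodesic I D.
Proof. by move=> r1 t It; rewrite D_velocity// /kappa_ext r1 scale0r. Qed.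

Lemma not_geodesic : (1 < r)%N -> ~ geodesic I D.
Proof.
move=> r1 geo; have [_ _ [t It]] := hI.
have := geo t It; rewrite D_velocity// => /(congr1 (fun v => g _ v (frame_ext 2 t))).
rewrite gm0 gmZ frame_ext_orthonormal// mulr1 /kappa_ext r1 => k0.
by have := ff_kappa_pos hE (i := 1%N) r1 It; rewrite k0 ltxx.
Qed.

(** The components of the bitension along the frame vanish. The first one makes
    kappa_1 constant, the second one then gives kappa_1^2 + kappa_2^2 = 1, and
    the fourth one, kappa_1 kappa_2 kappa_3 = 0, excludes order at least 4. *)
Lemma biharmonic_curvatures : biharmonic I nabla D -> (1 < r)%N ->
  [/\ forall s t, I s -> I t -> kappa 1%N s = kappa 1%N t,
      forall t, I t -> kappa_ext 1 t ^+ 2 + kappa_ext 2 t ^+ 2 = 1 & (r <= 3)%N].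
Proof.
move=> bih r1.
have k1E : kappa_ext 1 = kappa 1%N by rewrite /kappa_ext r1.
have k1pos t : I t -> 0 < kappa_ext 1 t.
  by rewrite k1E; apply: (ff_kappa_pos hE).
have comp i t : I t -> (0 < i <= r)%N -> g (gamma t) (bitension nabla D t) (frame_ext i t) = 0.
  by move=> It _; rewrite bih// gm0.
have dk1 t : I t -> 'D_1 (kappa_ext 1) t = 0.
  move=> It; have r1' : (0 < 1 <= r)%N by rewrite order_gt0.
  have := comp 1%N t It r1'; rewrite bitensionE// !gmE !frame_ext_orthonormal//=.
  rewrite !mulr0 !addr0 mulr1 => /eqP; rewrite oppr_eq0 !mulf_eq0 pnatr_eq0/=.
  by rewrite gt_eqF ?k1pos// => /eqP.
have ddk1 t : I t -> 'D_1 ('D_1 (kappa_ext 1)) t = 0.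
  exact: (derive_locally_cst dk1).
split.
- by rewrite -k1E; apply: derive0_cst => //; exact: kappa_ext_smooth.
- move=> t It; have := comp 2%N t It r1; rewrite bitensionE// !gmE !frame_ext_orthonormal//=.
  rewrite ddk1// !mulr0 add0r !addr0 mulr1 sub0r => /eqP.
  by rewrite oppr_eq0 mulf_eq0 gt_eqF ?k1pos//= subr_eq0 => /eqP.
- rewrite leqNgt; apply/negP => r3; have [_ _ [t It]] := hI.
  have := comp 4%N t It r3; rewrite bitensionE// !gmE !frame_ext_orthonormal//=.
  rewrite !mulr0 !add0r mulr1 => /eqP; apply/negP; rewrite /kappa_ext r1 r3 (ltnW r3).
  by rewrite !mulf_neq0// gt_eqF//; apply: (ff_kappa_pos hE) It; rewrite ?r1 ?r3 ?(ltnW r3).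
Qed.

Lemma constant_curvatures_biharmonic (k1 k2 : R) :
  (forall t, I t -> kappa_ext 1 t = k1 /\ kappa_ext 2 t = k2) -> kappa_ext 3 = cst 0 ->
  k1 ^+ 2 + k2 ^+ 2 = 1 -> biharmonic I nabla D.
Proof.
move=> kE k3 k12 t It; rewrite bitensionE//; have [k1t k2t] := kE t It.
have dk1 s : I s -> 'D_1 (kappa_ext 1) s = 0.
  by move=> Is; apply: (@derive_locally_cst _ k1) => // u /kE [].
have dk2 : 'D_1 (kappa_ext 2) t = 0.
  by apply: (@derive_locally_cst _ k2) => // u /kE [].
have ddk1 : 'D_1 ('D_1 (kappa_ext 1)) t = 0 by exact: (derive_locally_cst dk1 It).
rewrite ddk1 dk1// dk2 k3 k1t k2t k12 /=.
by apply: tangent_ext => f; rewrite !tevE; ring.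
Qed.

End Frenet.
End Curves.

Theorem theorem3p2 (R : realType) (n : nat) (N : manifold R n.*2.+1)
    (phi : endofield N) (xi : vfield N) (eta : oneform N) (g : metric N)
    (nabla : connection N) (hLC : levi_civita g nabla)
    (hN : sasakian_space_form phi xi eta g nabla 1)
    (I : set R) (hI : open_interval I)
    (gamma : R -> N) (hgamma : smooth_curve I gamma)
    (D : along gamma -> along gamma)
    (hD : covariant_derivative_along I nabla D)
    (r : nat) (hr : frenet_curve I g D r)
    (hnl : non_legendre I gamma eta) :
  proper_biharmonic I nabla D <->
  circle I g D 1 \/
  exists k1 k2 : R, helix I g D k1 k2 /\ k1 ^+ 2 + k2 ^+ 2 = 1.
Proof.
have Riem1 := Riem_space_form hLC hN.
split; last first.
- case=> [[E [kappa [hE k1]]]|[k1 [k2 [[E [kappa [hE k12]]] k121]]]].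
  + split; last exact: (not_geodesic hI hD hE).
    apply: (constant_curvatures_biharmonic hI hD hE Riem1 (k1 := 1) (k2 := 0)) => //.
    * by move=> t It; rewrite /kappa_ext /= k1.
    * by rewrite expr1n expr0n addr0.
  + split; last exact: (not_geodesic hI hD hE).
    exact: (constant_curvatures_biharmonic hI hD hE Riem1 (k1 := k1) (k2 := k2)).
case=> bih ngeo; case: hr => E [kappa hE].
have r1 : (1 < r)%N.
  rewrite ltn_neqAle (order_gt0 hE) andbT eq_sym; apply/eqP => r1.
  exact: ngeo (geodesic_order1 hI hD hE r1).
have [k1c k12 r3] := biharmonic_curvatures hI hD hE Riem1 bih r1.
have [_ _ [t0 It0]] := hI.
have pos i t : (1 <= i < r)%N -> I t -> 0 < kappa i t by move=> ir; exact: (ff_kappa_pos hE ir).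
move: r3; rewrite leq_eqVlt ltnS => /orP[/eqP r3|r2].
- right; exists (kappa 1%N t0), (kappa 2%N t0); subst r; split; last exact: k12.
  exists E, kappa; split=> // t It; split; first exact: k1c.
  (* kappa_2 is positive with a constant square *)
  have := k12 t It; rewrite -(k12 t0 It0) /kappa_ext /= (k1c t t0)// => /addrI.
  by move=> /eqP; rewrite eqrXn2 ?ltW ?pos// => /eqP.
- left; have r2' : r = 2%N by apply/eqP; rewrite eqn_leq r2.
  subst r; exists E, kappa; split => // t It.
  have := k12 t It; rewrite /kappa_ext /= expr0n addr0 => /eqP.
  by rewrite sqrp_eq1 ?ltW ?pos// => /eqP.
Qed.
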